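(* Let $A$ be a $\mathbb{Z}$-graded integral domain, let $a,b\in A\setminus\{0\}$ be homogeneous and relatively prime (i.e. $aA\cap bA=abA$), and let $n>0$ be an integer with $\gcd(n,\deg b-\deg a)=1$. Let $A[Z]$ be the polynomial ring in one variable over $A$. (a) $(aZ^n-b)$ is a prime ideal of $A[Z]$. (b) Assume moreover that $A$ is a noetherian UFD, that $b$ is a prime element of $A$, and that $pA+bA$ is a prime ideal of $A$ for every prime element $p$ of $A$ satisfying $a\in pA$ and $pA+bA\neq A$. Then $B:=A[Z]/(aZ^n-b)$ is a UFD and $\mathrm{frac}(B)\cong\mathrm{frac}(A)$. *)

(* Defs.v *)
From HB Require Import structures.
From mathcomp Require Import all_boot all_order all_algebra.
Set Implicit Arguments. Unset Strict Implicit. Unset Printing Implicit Defensive.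
Import Order.TTheory GRing.Theory Num.Theory.
Local Open Scope ring_scope.

Definition divides (R : comRingType) (x y : R) : Prop := exists z, y = x * z.

Definition is_Zgrading (A : comRingType) (G : int -> A -> Prop) : Prop :=
  [/\ (forall d, G d 0),
      (forall d x y, G d x -> G d y -> G d (x - y)),
      (forall i j x y, G i x -> G j y -> G (i + j) (x * y)),
      (forall x : A, exists (s : seq int) (f : int -> A),
          [/\ uniq s, (forall d, G d (f d)) & x = \sum_(d <- s) f d])
    & (forall (s : seq int) (f : int -> A), uniq s -> (forall d, G d (f d)) ->
          \sum_(d <- s) f d = 0 -> forall d, d \in s -> f d = 0)].

Definition is_ideal (R : comRingType) (I : R -> Prop) : Prop :=
  [/\ I 0, (forall x y, I x -> I y -> I (x + y)) & (forall r x, I x -> I (r * x))].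

Definition prime_ideal (R : comRingType) (I : R -> Prop) : Prop :=
  [/\ is_ideal I, ~ I 1 & forall x y, I (x * y) -> I x \/ I y].

Definition pideal (R : comRingType) (p : R) : R -> Prop := fun x => divides p x.

Definition sum2ideal (R : comRingType) (p q : R) : R -> Prop :=
  fun x => exists u v, x = p * u + q * v.

Definition noetherian (R : comRingType) : Prop :=
  forall I : nat -> R -> Prop, (forall k, is_ideal (I k)) ->
    (forall k x, I k x -> I k.+1 x) ->
    exists N, forall m x, (N <= m)%N -> I m x -> I N x.

Definition irreducible_elt (R : idomainType) (x : R) : Prop :=
  [/\ x != 0, x \isn't a GRing.unit &
      forall y z, x = y * z -> y \is a GRing.unit \/ z \is a GRing.unit].

Definition prime_elt (R : idomainType) (p : R) : Prop :=
  [/\ p != 0, p \isn't a GRing.unit &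
      forall x y, divides p (x * y) -> divides p x \/ divides p y].

Definition UFD (R : idomainType) : Prop :=
  (forall x : R, x != 0 -> x \isn't a GRing.unit ->
     exists s : seq R, (forall y, y \in s -> irreducible_elt y) /\
                       x = \prod_(y <- s) y)
  /\
  (forall s t : seq R,
     (forall y, y \in s -> irreducible_elt y) ->
     (forall y, y \in t -> irreducible_elt y) ->
     \prod_(y <- s) y = \prod_(y <- t) y ->
     exists u : seq R, [/\ size u = size s,
        (forall v, v \in u -> v \is a GRing.unit) &
        perm_eq [seq yv.1 * yv.2 | yv <- zip s u] t]).

(* Main.v *)
(** Let [K = frac A] and call [x / s] with [x], [s] homogeneous a homogeneous fraction.
    After dividing all degrees by their gcd, there is a homogeneous fraction [y] of degree 1
    (or everything has degree 0, and then [n = 1]). Write [b / a = c y^d] with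
    [d = deg b - deg a] and [c] of degree 0. As [u n + v d = 1], [c^(1 - v d)] is an n-th
    power, so sending a homogeneous [x] of degree [i] to [x rho^i], where
    [rho = y^(n-1) c^(-v)], and [Z] to [zeta = y^d c^u] defines a ring morphism
    [A[Z] -> K] killing [a Z^n - b]. It multiplies degrees by [n], so [x_i Z^j] lands in
    degree [n i + d j]; these degrees are distinct for [j < n], and pseudo-division together
    with coprimality shows that the kernel is exactly [(a Z^n - b)]. This gives (a), embeds
    [B] in [K] with [frac B = K], and grades [B].

    A graded domain is factorial as soon as its nonzero homogeneous elements are products of
    primes (Nagata's lemma for the homogeneous primes). In [B], a homogeneous element is, up
    to a power of [a], of the form [x z^j] with [x] in [A]. The class [z] is prime because
    [B / z = A / b], a prime [p] dividing [a] is prime or a unit because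
    [B / p = (A / (p, b))[Z]], and any other homogeneous prime [q] of [A] becomes prime in
    [B] after dividing out finitely many of the [p]'s; noetherianity of [A] is only used,
    through Krull's intersection theorem, for this finiteness. *)

Require Import Defs.
From HB Require Import structures.
From mathcomp Require Import all_boot all_order all_algebra.
From mathcomp Require Import ring zify.
From Stdlib Require Import Classical ClassicalEpsilon.
Set Implicit Arguments. Unset Strict Implicit. Unset Printing Implicit Defensive.
Import Order.TTheory GRing.Theory Num.Theory.
Local Open Scope ring_scope.

(** * Divisibility and prime factorizations *)

Section Divisibility.
Context (R : idomainType).
Implicit Types x y z p c : R.

Lemma divides_refl x : divides x x.
Proof. by exists 1; rewrite mulr1. Qed.

Lemma divides0 x : divides x 0.
Proof. by exists 0; rewrite mulr0. Qed.

Lemma divides_mulr x y z : divides x y -> divides x (y * z).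
Proof. by move=> [w ->]; exists (w * z); rewrite mulrA. Qed.

Lemma divides_mull x y z : divides x y -> divides x (z * y).
Proof. by move=> dxy; rewrite mulrC; apply: divides_mulr. Qed.

Lemma divides_trans x y z : divides x y -> divides y z -> divides x z.
Proof. by move=> dxy [w ->]; apply: divides_mulr. Qed.

Lemma dividesD x y z : divides x y -> divides x z -> divides x (y + z).
Proof. by move=> [u ->] [v ->]; exists (u + v); rewrite mulrDr. Qed.

Lemma dividesN x y : divides x y -> divides x (- y).
Proof. by move=> [u ->]; exists (- u); rewrite mulrN. Qed.

Lemma divides_sum x (I : Type) (r : seq I) (P : pred I) (F : I -> R) :
  (forall i, P i -> divides x (F i)) -> divides x (\sum_(i <- r | P i) F i).
Proof.
move=> dF; apply: (big_ind (divides x)) => //; first exact: divides0.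
exact: dividesD.
Qed.

Lemma divides_unit x y : x \is a GRing.unit -> divides x y.
Proof. by move=> ux; exists (x^-1 * y); rewrite mulVKr. Qed.

Lemma divides_unitr x y : y \is a GRing.unit -> divides x y -> x \is a GRing.unit.
Proof. by move=> uy [z ez]; move: uy; rewrite ez unitrM => /andP[]. Qed.

Lemma divides_cancel z x y : z != 0 -> divides (z * x) (z * y) -> divides x y.
Proof. by move=> z0 [w]; rewrite -mulrA => /(mulfI z0) ->; exists w. Qed.

Lemma prime_not_unit p : prime_elt p -> ~ divides p 1.
Proof. by case=> _ /negP np _ /(divides_unitr (unitr1 R)). Qed.

Lemma prime_divides_exp p x k : prime_elt p -> divides p (x ^+ k) -> divides p x.
Proof.
move=> pp; elim: k => [|k IH]; first by rewrite expr0 => /(prime_not_unit pp).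
by rewrite exprS; case: (pp) => _ _ pr /pr[].
Qed.

Lemma prime_divides_prod p (s : seq R) : prime_elt p ->
  divides p (\prod_(y <- s) y) -> exists2 y, y \in s & divides p y.
Proof.
move=> pp; elim: s => [|y s IH]; first by rewrite big_nil => /(prime_not_unit pp).
rewrite big_cons; case: (pp) => _ _ pr /pr[dy|/IH[z zs dz]].
  by exists y; rewrite ?mem_head.
by exists z; rewrite // in_cons zs orbT.
Qed.

Lemma prime_irreducible p : prime_elt p -> irreducible_elt p.
Proof.
case=> p0 np pr; split=> // y z e.
have cancel_p u v : p = u * v -> divides p u -> v \is a GRing.unit.
  move=> e' [w ew]; apply/unitrP; exists w.
  have /(mulfI p0) h : p * (w * v) = p * 1 by rewrite mulr1 mulrA -ew.
  by rewrite h mulrC h.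
have /pr[dy|dz] : divides p (y * z) by rewrite -e; apply: divides_refl.
  by right; apply: cancel_p dy.
by left; apply: (@cancel_p z y) => //; rewrite mulrC.
Qed.

Lemma irreducible_divides p q : irreducible_elt p -> irreducible_elt q ->
  divides p q -> exists2 u, u \is a GRing.unit & q = p * u.
Proof.
move=> [_ /negP np _] [_ _ irr] [w e]; exists w => //.
by case: (irr _ _ e) => // /np.
Qed.

(* The number of prime factors is recorded because it serves as a termination measure. *)
Definition prime_factors k x := exists u (s : seq R),
  [/\ u \is a GRing.unit, (forall y, y \in s -> prime_elt y), size s = k
    & x = u * \prod_(y <- s) y].

Definition factorable x := exists k, prime_factors k x.

Lemma factorable_unit x : x \is a GRing.unit -> factorable x.
Proof. by exists 0%N, x, [::]; rewrite big_nil mulr1. Qed.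

Lemma factorable_prime x : prime_elt x -> factorable x.
Proof.
move=> px; exists 1%N, 1, [:: x]; rewrite big_seq1 mul1r; split=> //.
  exact: unitr1.
by move=> y; rewrite inE => /eqP ->.
Qed.

Lemma factorableM x y : factorable x -> factorable y -> factorable (x * y).
Proof.
move=> [k [u [s [uu ps sk ->]]]] [l [v [t [vu pt tl ->]]]].
exists (k + l)%N, (u * v), (s ++ t); split.
- by rewrite unitrM uu.
- by move=> z; rewrite mem_cat => /orP[/ps|/pt].
- by rewrite size_cat sk tl.
- by rewrite big_cat mulrACA.
Qed.

Lemma factorableX x k : factorable x -> factorable (x ^+ k).
Proof.
move=> fx; elim: k => [|k IH]; first by rewrite expr0; apply/factorable_unit/unitr1.
by rewrite exprS; apply: factorableM.
Qed.

(** Induction on the primes of [y]: each divides [x] or its cofactor and is cancelled there, until a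
    divisor of a unit remains. *)
Lemma factorable_divides x y : factorable y -> divides x y -> factorable x.
Proof.
move=> [k [u [s [uu ps _ ->]]]] [z]; move: ps x z.
elim: s => [|p s IH] ps x z.
  rewrite big_nil mulr1 => e; apply: factorable_unit.
  by move: uu; rewrite e unitrM => /andP[].
have [p0 _ pr] := ps p (mem_head _ _).
have ps' y0 : y0 \in s -> prime_elt y0 by move=> h; apply: ps; rewrite in_cons h orbT.
rewrite big_cons => e; have /pr[[w ew]|[w ew]] : divides p (x * z).
- by rewrite -e; exists (u * \prod_(j <- s) j); rewrite mulrCA.
- rewrite ew; apply: factorableM; first by apply/factorable_prime/ps/mem_head.
  apply: (IH ps' w z); apply: (mulfI p0).
  by rewrite mulrCA e ew mulrA.
- apply: (IH ps' x w); apply: (mulfI p0).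
  by rewrite mulrCA e ew mulrCA.
Qed.

(** [p] is associated to one of the listed primes, which is removed; the unit between them is
    absorbed in [u], so the count drops by exactly one. *)
Lemma prime_factors_cancel p x k : prime_elt p -> prime_factors k (p * x) ->
  exists2 k', k = k'.+1 & prime_factors k' x.
Proof.
move=> pp [u [s [uu ps sk e]]]; have [p0 /negP npu pr] := pp.
have : divides p (u * \prod_(y <- s) y) by rewrite -e; exists x.
case/pr=> [/(divides_unitr uu)//|/(prime_divides_prod pp)[y ys dy]].
have [v vu ey] := irreducible_divides (prime_irreducible pp)
  (prime_irreducible (ps y ys)) dy.
have sz : (0 < size s)%N by case: (s) ys.
exists (size s).-1; first by rewrite -sk prednK.
exists (u * v), (rem y s); split.
- by rewrite unitrM uu.
- by move=> z /mem_rem /ps.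
- by rewrite size_rem.
- apply: (mulfI p0); rewrite e (perm_big _ (perm_to_rem ys)) big_cons /= ey.
  by rewrite -!mulrA (mulrCA u).
Qed.

(* Gauss: an element coprime to every prime factor of [c] is cancellable modulo [c]. *)
Lemma gauss c g w : factorable c ->
  (forall p, prime_elt p -> divides p c -> ~ divides p g) ->
  divides c (g * w) -> divides c w.
Proof.
move=> [k [u [s [uu ps _ ->]]]]; elim: s ps w => [|p s IH] ps w cop dc.
  by rewrite big_nil mulr1; apply: divides_unit.
have pp : prime_elt p := ps p (mem_head _ _).
have [p0 _ pr] := pp; move: cop dc; rewrite big_cons mulrCA => cop dc.
have dpc : divides p (p * (u * \prod_(j <- s) j)).
  by apply/divides_mulr/divides_refl.
case/pr: (divides_trans dpc dc) => [/(cop _ pp dpc)//|[w' ew]].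
move: dc; rewrite ew (mulrCA g) => /(divides_cancel p0) dc.
have {dc} := IH _ w' _ dc; case=> [y ys|q pq dq|v ->].
- by apply: ps; rewrite in_cons ys orbT.
- by apply: cop => //; apply: divides_mull.
- by exists v; rewrite mulrA.
Qed.

(** The unit [u] serves the induction: each matching of a prime with an associate in [t] leaves a
    unit behind. *)
Lemma prime_factorization_unique u (s t : seq R) : u \is a GRing.unit ->
  (forall y, y \in s -> prime_elt y) -> (forall y, y \in t -> irreducible_elt y) ->
  \prod_(y <- s) y = u * \prod_(y <- t) y ->
  exists v : seq R, [/\ size v = size s, (forall w, w \in v -> w \is a GRing.unit)
    & perm_eq [seq yv.1 * yv.2 | yv <- zip s v] t].
Proof.
elim: s u t => [|p s IH] u t uu ps it.
  rewrite big_nil; case: t it => [|y t] it; first by exists [::].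
  rewrite big_cons mulrCA => e; have [_ /negP[]] := it y (mem_head _ _).
  by apply: (divides_unitr (unitr1 R)); rewrite e; exists (u * \prod_(j <- t) j).
have pp : prime_elt p := ps p (mem_head _ _); have [p0 /negP npu pr] := pp.
rewrite big_cons => e.
have : divides p (u * \prod_(y <- t) y) by rewrite -e; apply/divides_mulr/divides_refl.
case/pr=> [/(divides_unitr uu)//|/(prime_divides_prod pp)[y yt dy]].
have [v vu ey] := irreducible_divides (prime_irreducible pp) (it y yt) dy.
have [||||vs [sv uv pv]] := IH (u * v) (rem y t).
- by rewrite unitrM uu.
- by move=> z zs; apply: ps; rewrite in_cons zs orbT.
- by move=> z /mem_rem /it.
- apply: (mulfI p0); rewrite e (perm_big _ (perm_to_rem yt)) big_cons /= ey.
  by rewrite -!mulrA (mulrCA u).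
exists (v :: vs); split=> /=; first by rewrite sv.
  by move=> w; rewrite inE => /orP[/eqP ->|/uv].
by rewrite -ey (perm_trans _ (_ : perm_eq (y :: rem y t) t)) ?perm_cons // perm_sym perm_to_rem.
Qed.

(** An irreducible element is associated to the first prime of its factorization, hence prime;
    uniqueness then reduces to lists of primes. *)
Lemma factorable_UFD : (forall x, x != 0 -> factorable x) -> UFD R.
Proof.
move=> fR.
have irr_prime y : irreducible_elt y -> prime_elt y.
  move=> iy; have [y0 /negP ny irr] := iy.
  have [k [u [[|p s] [uu ps _ e]]]] := fR y y0.
    by case: ny; rewrite e big_nil mulr1.
  have pp := ps p (mem_head _ _).
  have [||v vu ->] := @irreducible_divides p y _ iy; first exact: prime_irreducible.
    by rewrite e big_cons mulrCA; apply/divides_mulr/divides_refl.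
  have [p0 np pr] := pp; split.
  - by rewrite mulf_neq0 //; apply: contraTneq vu => ->; rewrite unitr0.
  - by rewrite unitrM vu andbT.
  - move=> a b [w ew]; have pv c : divides p c -> divides (p * v) c.
      by move=> [d ->]; exists (v^-1 * d); rewrite -mulrA mulVKr.
    have /pr[/pv|/pv] : divides p (a * b) by rewrite ew -mulrA; apply/divides_mulr/divides_refl.
      by left.
    by right.
split=> [x x0 /negP nx|s t si ti e]; last first.
  apply: (@prime_factorization_unique 1); rewrite ?unitr1 ?mul1r //.
  by move=> y /si /irr_prime.
have [k [u [[|p s] [uu ps _ e]]]] := fR x x0.
  by case: nx; rewrite e big_nil mulr1.
(* [UFD] allows no unit in front of the product, so [u] is merged into the first prime. *)
exists (u * p :: s); rewrite big_cons e big_cons mulrA; split=> // y.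
rewrite inE => /orP[/eqP ->|ys]; last by apply: prime_irreducible; apply: ps; rewrite in_cons ys orbT.
have [p0 np pi] := prime_irreducible (ps p (mem_head _ _)); split.
- by rewrite mulf_neq0 //; apply: contraTneq uu => ->; rewrite unitr0.
- by rewrite unitrM uu.
- move=> a b ab; have /pi[] : p = (u^-1 * a) * b by rewrite -mulrA -ab mulKr.
    by rewrite unitrM unitrV uu; left.
  by right.
Qed.

Lemma UFD_irreducible_prime p : UFD R -> irreducible_elt p -> prime_elt p.
Proof.
move=> [ex un] ip; have [p0 np irr] := ip; split=> // x y [z e].
have [->|x0] := eqVneq x 0; first by left; apply: divides0.
have [->|y0] := eqVneq y 0; first by right; apply: divides0.
have [ux|nx] := boolP (x \is a GRing.unit).
  right; exists (x^-1 * z); rewrite mulrCA -e mulKr //.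
have [uy|ny] := boolP (y \is a GRing.unit).
  left; exists (y^-1 * z); rewrite mulrCA -e [x * y]mulrC mulKr //.
have z0 : z != 0 by apply: contraNneq (mulf_neq0 x0 y0) => z0; rewrite e z0 mulr0.
have [s [si es]] := ex x x0 nx; have [t [ti et]] := ex y y0 ny.
(* If [z] is a unit, [p * z] is itself irreducible and forms a list of length one; otherwise [p]
   heads the factors of [z]. *)
have [h [r [hri ph er]]] : exists h (r : seq R),
    [/\ forall w, w \in h :: r -> irreducible_elt w, divides p h
      & p * z = \prod_(w <- h :: r) w].
  have [uz|nz] := boolP (z \is a GRing.unit).
    exists (p * z), [::]; rewrite big_seq1; split=> [w||//]; last first.
      by apply/divides_mulr/divides_refl.
    rewrite inE => /eqP ->.
    split; rewrite ?mulf_neq0 // ?unitrM ?negb_and ?np // => v w' evw.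
    have /irr[h|] : p = v * (w' * z^-1) by rewrite mulrA -evw mulrK.
      by left.
    by rewrite unitrM => /andP[h _]; right.
  have [r [ri er]] := ex z z0 nz; exists p, r; rewrite big_cons -er; split=> // [w|].
    by rewrite inE => /orP[/eqP ->|/ri].
  exact: divides_refl.
have {}e : \prod_(w <- h :: r) w = \prod_(w <- s ++ t) w.
  by rewrite -er big_cat /= -es -et.
have sti w : w \in s ++ t -> irreducible_elt w by rewrite mem_cat => /orP[/si|/ti].
have [[|v0 v] [] //= _ _ /perm_mem pv] := un _ _ hri sti e.
have pw : divides p (h * v0) by apply: divides_mulr.
have : h * v0 \in s ++ t by rewrite -pv mem_head.
rewrite mem_cat => /orP[ws|wt]; [left|right]; apply: divides_trans pw _.
  by rewrite es (big_rem _ ws) /=; apply/divides_mulr/divides_refl.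
by rewrite et (big_rem _ wt) /=; apply/divides_mulr/divides_refl.
Qed.

Lemma UFD_factorable x : UFD R -> x != 0 -> factorable x.
Proof.
move=> uR x0; have [/factorable_unit//|nx] := boolP (x \is a GRing.unit).
have [s [si ->]] := uR.1 x x0 nx; exists (size s), 1, s; rewrite mul1r.
by split=> // [|y /si]; [exact: unitr1|exact: UFD_irreducible_prime].
Qed.

End Divisibility.

(** * Graded domains *)

Lemma ex_least (P : nat -> Prop) : (exists k, P k) ->
  exists2 m, P m & forall k, (k < m)%N -> ~ P k.
Proof.
move=> [k]; elim/ltn_ind: k => k IH Pk.
case: (classic (exists2 j, (j < k)%N & P j)) => [[j jk /(IH _ jk)]//|h].
by exists k => // j jk Pj; apply: h; exists j.
Qed.

Lemma ideal_sum (R : comNzRingType) (J : R -> Prop) (I : Type) (r : seq I)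
  (P : pred I) (F : I -> R) : is_ideal J -> (forall i, P i -> J (F i)) ->
  J (\sum_(i <- r | P i) F i).
Proof. by move=> [J0 JD _] JF; apply: (big_ind J). Qed.

(** Gauss's argument: for the least [i] and [j] with coefficients outside [J], every other term of
    the coefficient of index [i + j] lies in [J]. *)
Lemma least_coef_product (R : comNzRingType) (J : R -> Prop) (f g : {poly R}) :
  is_ideal J -> (forall i, J (f * g)`_i) ->
  (exists i, ~ J f`_i) -> (exists j, ~ J g`_j) ->
  exists i j, [/\ ~ J f`_i, ~ J g`_j & J (f`_i * g`_j)].
Proof.
move=> hJ Jfg /ex_least[i fi li] /ex_least[j gj lj]; exists i, j; split=> //.
have [J0 JD JM] := hJ.
have := Jfg (i + j)%N; rewrite coefM.
have le_i : (i < (i + j).+1)%N by lia.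
rewrite (bigD1 (Ordinal le_i)) //= addKn => Js.
set S := (X in _ + X) in Js.
have JS : J S.
  apply: ideal_sum => // k; rewrite -val_eqE /= => ki.
  have [lt_ki|le_ik] := ltnP k i.
    by rewrite mulrC; apply: JM; apply: NNPP => h; apply: (li k).
  apply: JM; apply: NNPP => h; apply: (lj (i + j - k)%N) => //.
  by move: (ltn_ord k); lia.
have -> : f`_i * g`_j = (f`_i * g`_j + S) + -1 * S by rewrite mulN1r addrK.
by apply: JD => //; apply: JM.
Qed.

Lemma sum_by_degree (V : nmodType) (I : eqType) (r : seq I) (deg : I -> int) (k : I -> V) :
  \sum_(d <- undup (map deg r)) \sum_(i <- r | deg i == d) k i = \sum_(i <- r) k i.
Proof.
rewrite (exchange_big_dep xpredT) //=; apply: eq_big_seq => i ir.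
rewrite (big_rem (deg i)) ?mem_undup ?map_f //= eqxx big1_seq ?addr0 // => e.
by rewrite mem_rem_uniq ?undup_uniq // inE /= => /andP[/eqP -> /andP[/eqP]].
Qed.

Section Graded.
Context (R : idomainType) (G : int -> R -> Prop).
Hypothesis hG : is_Zgrading G.
Implicit Types (x y f g p c : R) (P Q : {poly R}) (N M d : int).

Lemma gr0 d : G d 0. Proof. by case: hG. Qed.
Lemma grB d x y : G d x -> G d y -> G d (x - y). Proof. by case: hG => _ h *; apply: h. Qed.
Lemma grM d e x y : G d x -> G e y -> G (d + e) (x * y).
Proof. by case: hG => _ _ h *; apply: h. Qed.
Lemma grN d x : G d x -> G d (- x).
Proof. by move=> h; rewrite -sub0r; apply: grB => //; apply: gr0. Qed.
Lemma grD d x y : G d x -> G d y -> G d (x + y).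
Proof. by move=> hx hy; rewrite -[y]opprK; apply: grB => //; apply: grN. Qed.
Lemma gr_sum d (I : Type) (r : seq I) (S : pred I) (F : I -> R) :
  (forall i, S i -> G d (F i)) -> G d (\sum_(i <- r | S i) F i).
Proof. by move=> GF; apply: (big_ind (G d)) => //; [exact: gr0|exact: grD]. Qed.

(** The grading axiom takes one summand for each degree; here several summands may share a
    degree. *)
Lemma gr_components (I : eqType) (r : seq I) (deg : I -> int) (k : I -> R) :
  (forall i, G (deg i) (k i)) -> \sum_(i <- r) k i = 0 ->
  forall d, \sum_(i <- r | deg i == d) k i = 0.
Proof.
move=> hk sk d; have [_ _ _ _ ind] := hG.
pose F d := \sum_(i <- r | deg i == d) k i.
have GF e : G e (F e) by apply: gr_sum => i /eqP <-.
have [ds|ds] := boolP (d \in undup (map deg r)); last first.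
  rewrite big1_seq // => i /andP[/eqP ei ir].
  by case/negP: ds; rewrite mem_undup -ei map_f.
apply: (ind _ F (undup_uniq _) GF _ _ ds).
by rewrite /F sum_by_degree.
Qed.

(* [P] homogenizes its value at 1: its i-th coefficient is the component of degree [i - N]. *)
Definition hom_poly N P := forall i : nat, G (i%:Z - N) P`_i.

Lemma hom_polyB N P Q : hom_poly N P -> hom_poly N Q -> hom_poly N (P - Q).
Proof. by move=> hP hQ i; rewrite coefB; apply: grB. Qed.

Lemma hom_polyM N M P Q : hom_poly N P -> hom_poly M Q -> hom_poly (N + M) (P * Q).
Proof.
move=> hP hQ i; rewrite coefM; apply: gr_sum => j _.
have -> : i%:Z - (N + M) = (j%:Z - N) + ((i - j)%N%:Z - M) by move: (ltn_ord j); lia.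
exact: grM.
Qed.

Lemma hom_poly_monomial N x (k : nat) : G (k%:Z - N) x -> hom_poly N (x *: 'X^k).
Proof.
move=> gx i; rewrite coefZ coefXn.
by have [->|_] := eqVneq i k; rewrite ?mulr1 // mulr0; apply: gr0.
Qed.

Lemma hom_poly_sum N (I : Type) (r : seq I) (F : I -> {poly R}) :
  (forall i, hom_poly N (F i)) -> hom_poly N (\sum_(i <- r) F i).
Proof. by move=> hF i; rewrite coef_sum; apply: gr_sum => j _; apply: hF. Qed.

Lemma hom_poly_exists x : exists N P, hom_poly N P /\ P.[1] = x.
Proof.
have [_ _ _ dec _] := hG; have [s [F [us hF ->]]] := dec x.
pose N := \sum_(d <- s) `|d|%N.
have bound d : d \in s -> (`|d| <= N)%N.
  by move=> ds; rewrite /N (big_rem d) //= leq_addr.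
(* Adding [N] turns every degree in [s] into a natural exponent. Outside [s] the bound may fail,
   hence the default 0. *)
exists N%:Z, (\sum_(d <- s) (if d \in s then F d else 0) *: 'X^(absz (d + N%:Z))); split.
  apply: hom_poly_sum => d; apply: hom_poly_monomial.
  case: ifP => [/bound dN|_]; last exact: gr0.
  have -> : (absz (d + N%:Z))%:Z - N%:Z = d by lia.
  exact: hF.
rewrite horner_sum; apply: eq_big_seq => d ->.
by rewrite hornerZ hornerXn expr1n mulr1.
Qed.

Lemma hom_poly_eq0 N P : hom_poly N P -> P.[1] = 0 -> P = 0.
Proof.
move=> hP P1; apply/polyP => i; rewrite coef0.
have [lt|ge] := ltnP i (size P); last by rewrite nth_default.
have s0 : \sum_(j < size P) P`_j = 0.
  by rewrite -[RHS]P1 horner_coef; apply: eq_bigr => j _; rewrite expr1n mulr1.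
have := gr_components (deg := fun j : 'I_(size P) => j%:Z - N) (fun j => hP j) s0 (i%:Z - N).
rewrite (bigD1 (Ordinal lt)) //= big_pred0 ?addr0 // => j.
by rewrite -val_eqE /=; lia.
Qed.

(** A nonzero constant coefficient excludes extra powers of ['X] and makes [N] and [P] unique;
    [size P] then measures the spread of the degrees occurring in [x]. *)
Definition homogenization N x P := [/\ hom_poly N P, P`_0 != 0 & P.[1] = x].

Lemma homogenization_of_hom_poly N P : hom_poly N P -> P != 0 ->
  exists M Q, homogenization M P.[1] Q /\ (size Q <= size P)%N.
Proof.
elim/poly_ind: P N => [|P c IH] N hP; first by rewrite eqxx.
have [->|c0 _] := eqVneq c 0; last first.
  exists N, (P * 'X + c%:P); split=> //; split=> //.
  by rewrite coefD coefMX coefC add0r.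
rewrite addr0 => PX0; have P0 : P != 0 by apply: contraNneq PX0 => ->; rewrite mul0r.
have [i|//|M [Q [hQ sQ]]] := IH (N - 1).
  have := hP i.+1; rewrite coefD coefMX coefC /= addr0.
  by have -> : i.+1%:Z - N = i%:Z - (N - 1) by lia.
exists M, Q; rewrite hornerMX mulr1; split=> //.
by rewrite size_mulX // (leq_trans sQ).
Qed.

Lemma homogenization_exists x : x != 0 -> exists N P, homogenization N x P.
Proof.
have [N [P [hP <-]]] := hom_poly_exists x => x0.
have [|M [Q [hQ _]]] := homogenization_of_hom_poly hP; last by exists M, Q.
by apply: contraNneq x0 => ->; rewrite horner0.
Qed.

Lemma hom_poly_shift N (k : nat) P : hom_poly N P -> hom_poly (N + k%:Z) (P * 'X^k).
Proof.
move=> hP i; rewrite coefMXn; case: ltnP => ki; first exact: gr0.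
have -> : i%:Z - (N + k%:Z) = (i - k)%N%:Z - N by lia.
exact: hP.
Qed.

Lemma hom_poly_unique N M P Q : hom_poly N P -> hom_poly M Q -> P.[1] = Q.[1] ->
  N <= M -> exists2 k : nat, M = N + k%:Z & P * 'X^k = Q.
Proof.
move=> hP hQ e le.
have [k ek] : exists k : nat, M = N + k%:Z by exists `|M - N|%N; lia.
exists k => //; apply/subr0_eq/(@hom_poly_eq0 M).
  by apply: hom_polyB => //; rewrite ek; apply: hom_poly_shift.
by rewrite !hornerE e expr1n mulr1 subrr.
Qed.

Lemma homogenization_unique N M x P Q :
  homogenization N x P -> homogenization M x Q -> N = M /\ P = Q.
Proof.
wlog le : N M P Q / (N <= M)%R => [H hP hQ|[hP P0 P1] [hQ Q0 Q1]].
  have [/H h|/ltW /H h] := lerP N M; first exact: h.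
  by have [] := h _ _ hQ hP.
have [|k ek e] := hom_poly_unique hP hQ _ le; first by rewrite P1.
have k0 : k = 0%N.
  by case: (k) e => // j e; move: Q0; rewrite -e coefMXn eqxx.
by move: e; rewrite ek k0 expr0 mulr1 addr0.
Qed.

Lemma homogenizationM N M x y P Q : homogenization N x P -> homogenization M y Q ->
  homogenization (N + M) (x * y) (P * Q).
Proof.
move=> [hP P0 <-] [hQ Q0 <-]; split; first exact: hom_polyM.
  by rewrite coef0M mulf_neq0.
by rewrite hornerM.
Qed.

Lemma homogenization_neq0 N x P : homogenization N x P -> P != 0.
Proof. by case=> _ P0 _; apply: contraNneq P0 => ->; rewrite coef0. Qed.

Lemma homogenization_homogeneous d x : G d x -> x != 0 -> homogenization (- d) x x%:P.
Proof.
move=> gx x0; split; rewrite ?coefC ?hornerC // => -[|i]; rewrite coefC /=.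
  by rewrite sub0r opprK.
exact: gr0.
Qed.

Definition homogeneous x := exists d, G d x.

Lemma homogenization_coef N x P i : homogenization N x P -> homogeneous P`_i.
Proof. by case=> hP _ _; exists (i%:Z - N). Qed.

Lemma homogenization_size1 N x P : homogenization N x P -> (size P <= 1)%N -> homogeneous x.
Proof.
move=> hx /size1_polyC e; case: (hx) => _ _ <-; rewrite e hornerC.
exact: homogenization_coef hx.
Qed.

Lemma homogenization_size1E N x P :
  homogenization N x P -> homogeneous x -> size P = 1%N.
Proof.
move=> hx [d gx]; have x0 : x != 0.
  apply: contraTneq isT => x0; case: hx => hP P0; rewrite x0 => /(hom_poly_eq0 hP) e.
  by move: P0; rewrite e coef0 eqxx.
have [_ ->] := homogenization_unique hx (homogenization_homogeneous gx x0).
by rewrite size_polyC x0.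
Qed.

Lemma homogeneousM x y : homogeneous x -> homogeneous y -> homogeneous (x * y).
Proof. by move=> [d hx] [e hy]; exists (d + e); apply: grM. Qed.

(** For homogenizations, [size (P * Q)] is [size P + size Q - 1], so a product of size 1 has factors
    of size 1. *)
Lemma homogeneous_divisor x y : x * y != 0 -> homogeneous (x * y) -> homogeneous x.
Proof.
rewrite mulf_eq0 negb_or => /andP[x0 y0] hxy.
have [N [P hP]] := homogenization_exists x0; have [M [Q hQ]] := homogenization_exists y0.
apply: (homogenization_size1 hP).
have := homogenization_size1E (homogenizationM hP hQ) hxy.
have P0 := homogenization_neq0 hP; have Q0 := homogenization_neq0 hQ.
rewrite size_mul //; have : size Q != 0%N by rewrite size_poly_eq0.
by lia.
Qed.

Lemma homogeneous_divides x y : y != 0 -> homogeneous y -> divides x y -> homogeneous x.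
Proof. by move=> y0 hy [z e]; apply: (@homogeneous_divisor x z); rewrite -e. Qed.

(** Uniqueness of the homogenization of [1 = 1 * 1] gives [N = N + N] and [P = P * P], hence [N = 0]
    and [P = 1]. *)
Lemma gr1 : G 0 1.
Proof.
have [N [P hP]] := homogenization_exists (oner_neq0 R).
have := homogenizationM hP hP; rewrite mulr1 => hPP.
have [e eP] := homogenization_unique hP hPP.
have P0 := homogenization_neq0 hP.
have {eP} P1 : P = 1 by apply: (mulfI P0); rewrite mulr1.
case: hP => /(_ 0%N); rewrite P1 coef1 /=.
by have -> : 0%:Z - N = 0 by lia.
Qed.

Lemma homogeneous_unit x : x \is a GRing.unit -> homogeneous x.
Proof.
move=> ux; apply: (@homogeneous_divides x 1); first exact: oner_neq0.
  by exists 0; apply: gr1.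
exact: divides_unit.
Qed.

Lemma divides_homogenization N p f P : homogenization N f P ->
  homogeneous p -> divides p f ->
  exists r M Q, [/\ f = p * r, homogenization M r Q & P = p *: Q].
Proof.
move=> hP [d gp] [r e]; exists r.
have : f != 0.
  apply: contraTneq isT => f0; case: hP => hP P0; rewrite f0 => /(hom_poly_eq0 hP) e'.
  by move: P0; rewrite e' coef0 eqxx.
rewrite e mulf_eq0 negb_or => /andP[p0 r0].
have [M [Q hQ]] := homogenization_exists r0; exists M, Q; split=> //.
have := homogenizationM (homogenization_homogeneous gp p0) hQ.
rewrite -e => h; have [_ ->] := homogenization_unique hP h.
by rewrite mul_polyC.
Qed.

Lemma divides_homogenization_coef N p f P : homogenization N f P ->
  homogeneous p -> divides p f -> forall i, divides p P`_i.
Proof.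
move=> hP hp df i; have [r [M [Q [_ _ ->]]]] := divides_homogenization hP hp df.
by rewrite coefZ; apply/divides_mulr/divides_refl.
Qed.

Lemma homogenization_divides N p f P : homogenization N f P ->
  (forall i, divides p P`_i) -> divides p f.
Proof.
case=> _ _ <- h; rewrite horner_coef; apply: divides_sum => i _.
exact: divides_mulr.
Qed.

Lemma is_ideal_divides p : is_ideal (divides p).
Proof.
split; [exact: divides0|exact: dividesD|by move=> r x; apply: divides_mull].
Qed.

(** A homogeneous [p] divides an element exactly when it divides all its components, so
    [least_coef_product] turns a failing pair into a homogeneous one. *)
Lemma homogeneous_prime_test p : p != 0 -> p \isn't a GRing.unit -> homogeneous p ->
  (forall x y, homogeneous x -> homogeneous y -> divides p (x * y) ->
     divides p x \/ divides p y) -> prime_elt p.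
Proof.
move=> p0 np hp test; split=> // f g dfg.
case: (classic (divides p f)) => [|nf]; first by left.
case: (classic (divides p g)) => [|ng]; first by right.
have f0 : f != 0 by apply: contra_not_neq nf => ->; apply: divides0.
have g0 : g != 0 by apply: contra_not_neq ng => ->; apply: divides0.
have [N [P hP]] := homogenization_exists f0; have [M [Q hQ]] := homogenization_exists g0.
have some_coef L h H : homogenization L h H -> ~ divides p h -> exists i, ~ divides p H`_i.
  move=> hH nh; apply: NNPP => none; apply: nh; apply: (homogenization_divides hH) => i.
  by apply: NNPP => ni; apply: none; exists i.
have [i [j [ni nj]]] := least_coef_product (is_ideal_divides p)
  (divides_homogenization_coef (homogenizationM hP hQ) hp dfg)
  (some_coef _ _ _ hP nf) (some_coef _ _ _ hQ ng).
by case/test => //; apply: homogenization_coef; eassumption.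
Qed.

(** * Factoriality from the factorization of homogeneous elements *)

Section GradedFactorial.
Hypothesis fact : forall x, homogeneous x -> x != 0 -> factorable x.

Definition primitive f := forall p, prime_elt p -> homogeneous p -> ~ divides p f.

(** Homogeneous primes are pulled out of [f] one by one. Each divides the constant coefficient of
    [P], whose number of prime factors bounds the process. *)
Lemma primitive_part N f P : homogenization N f P ->
  exists c g M Q, [/\ homogeneous c, c != 0, f = c * g, primitive g &
    homogenization M g Q /\ size Q = size P].
Proof.
move=> hP; have [_ P0 _] := hP.
have [k fk] := fact (homogenization_coef 0 hP) P0.
elim: k N f P hP {P0} fk => [|k IH] N f P hP fk.
  exists 1, f, N, P; rewrite mul1r oner_neq0; split=> //; first by exists 0; apply: gr1.
  move=> p pp hp /(divides_homogenization_coef hP hp)/(_ 0%N) [z e].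
  by rewrite e in fk; have [] := prime_factors_cancel pp fk.
case: (classic (primitive f)) => [pf|npf].
  exists 1, f, N, P; rewrite mul1r oner_neq0; split=> //; by exists 0; apply: gr1.
have [p [pp hp df]] : exists p, [/\ prime_elt p, homogeneous p & divides p f].
  by apply: NNPP => h; apply: npf => p pp hp df; apply: h; exists p.
have [r [M [Q [e hQ eP]]]] := divides_homogenization hP hp df.
move: fk; rewrite eP coefZ => /(prime_factors_cancel pp)[k' [<-] fk].
have [c [g [L [S [hc c0 er pg [hS sS]]]]]] := IH _ _ _ hQ fk.
have [p0 _ _] := pp; exists (p * c), g, L, S; split=> //.
- exact: homogeneousM.
- exact: mulf_neq0.
- by rewrite e er mulrA.
- by rewrite size_scale.
Qed.

(** All prime divisors of a homogeneous [c] are homogeneous, so none of them divides the primitive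
    [g] and Gauss's lemma applies. *)
Lemma primitive_gauss c g w : homogeneous c -> c != 0 -> primitive g ->
  divides c (g * w) -> divides c w.
Proof.
move=> hc c0 pg; apply: gauss; first exact: fact.
by move=> p pp dpc; apply: pg => //; apply: homogeneous_divides dpc.
Qed.

Lemma primitive_homogeneous_unit f : f != 0 -> primitive f -> homogeneous f ->
  f \is a GRing.unit.
Proof.
move=> f0 pf hf; have [k [u [[|p s] [uu ps _ e]]]] := fact hf f0.
  by rewrite e big_nil mulr1.
have dp : divides p f by rewrite e big_cons mulrCA; apply/divides_mulr/divides_refl.
case: (pf p) => //; first by apply: ps; rewrite mem_head.
exact: homogeneous_divides dp.
Qed.

Lemma primitive_divisor f g : primitive f -> divides g f -> primitive g.
Proof. by move=> pf df p pp hp dp; apply: (pf p) => //; apply: divides_trans df. Qed.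

(* One step of pseudo-division: the leading components are homogeneous, so
   cross-multiplying by them cancels the top component without spreading the others. *)
Lemma pseudo_division_step N M v g V H : homogenization N v V -> homogenization M g H ->
  (size H <= size V)%N ->
  exists a b, [/\ homogeneous a, a != 0 &
    a * v - b * g = 0 \/ exists L W, homogenization L (a * v - b * g) W /\
      (size W < size V)%N].
Proof.
move=> hV hH le; have V0 := homogenization_neq0 hV; have H0 := homogenization_neq0 hH.
have sV : size V != 0%N by rewrite size_poly_eq0.
have sH : size H != 0%N by rewrite size_poly_eq0.
exists (lead_coef H), (lead_coef V).
have hlH := homogenization_coef (size H).-1 hH.
rewrite lead_coef_eq0; split=> //.
have [W0|nz] := eqVneq (lead_coef H * v - lead_coef V * g) 0; first by left.
right; pose W := lead_coef H *: V - lead_coef V *: ('X^(size V - size H) * H).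
have eW : W.[1] = lead_coef H * v - lead_coef V * g.
  by case: hV hH => _ _ <- [_ _ <-]; rewrite hornerD hornerN !hornerZ hornerM hornerXn expr1n mul1r.
have hW : hom_poly (N + M - (size H).-1%:Z) W.
  case: hV hH => hV _ _ [hH _ _]; apply: hom_polyB => i; rewrite coefZ.
    have -> : i%:Z - (N + M - (size H).-1%:Z) = ((size H).-1%:Z - M) + (i%:Z - N) by lia.
    by apply: grM; [apply: hH|apply: hV].
  rewrite coefXnM; case: ltnP => lt; first by rewrite mulr0; apply: gr0.
  have -> : i%:Z - (N + M - (size H).-1%:Z) =
    ((size V).-1%:Z - N) + ((i - (size V - size H))%N%:Z - M) by lia.
  by apply: grM; [apply: hV|apply: hH].
have W0 : W != 0 by apply: contraNneq nz => h; rewrite -eW h horner0.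
have [L [S [hS sS]]] := homogenization_of_hom_poly hW W0.
exists L, S; rewrite -eW; split=> //; apply: leq_ltn_trans sS _.
have sz : (size W <= size V)%N.
  rewrite (leq_trans (size_polyD _ _)) // size_polyN geq_max !size_scale ?lead_coef_eq0 //.
  by rewrite leqnn mulrC size_mulXn // subnK /=.
rewrite ltn_neqAle sz andbT; apply: contra_neq W0 => eW'; apply/eqP.
rewrite -lead_coef_eq0 lead_coefE eW' coefB !coefZ coefXnM.
have -> : ((size V).-1 < size V - size H)%N = false by lia.
have -> : ((size V).-1 - (size V - size H) = (size H).-1)%N by lia.
by rewrite -!lead_coefE mulrC subrr.
Qed.

(** Euclidean division inside [J]: by minimality of [H] every nonzero pseudo-remainder can be
    divided again, until the division is exact. The homogeneous multipliers collect in [a]. *)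
Lemma minimal_size_divides M g H (J : R -> Prop) : is_ideal J -> J g ->
  homogenization M g H ->
  (forall N v V, J v -> homogenization N v V -> (size H <= size V)%N) ->
  forall v, J v -> exists a, [/\ homogeneous a, a != 0 & divides g (a * v)].
Proof.
move=> [J0 JD JM] Jg hH min v Jv.
have [->|v0] := eqVneq v 0.
  by exists 1; rewrite oner_neq0 mulr0; split=> //; [exists 0; apply: gr1|apply: divides0].
have [N [V hV]] := homogenization_exists v0.
have [k] : exists k, size V = k by exists (size V).
elim/ltn_ind: k N v V Jv {v0} hV => k IH N v V Jv hV sV.
have [a [b [ha a0 h]]] := pseudo_division_step hV hH (min _ _ _ Jv hV).
case: h => [/subr0_eq e|[L [W [hW sW]]]].
  by exists a; split=> //; rewrite e; apply/divides_mull/divides_refl.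
have Jw : J (a * v - b * g) by apply: JD; [apply: JM|rewrite -mulNr; apply: JM].
rewrite sV in sW; have [c [hc c0 dc]] := IH _ sW _ _ _ Jw hW erefl.
exists (c * a); split; [exact: homogeneousM|exact: mulf_neq0|].
have -> : c * a * v = c * (a * v - b * g) + c * b * g by ring.
by apply: dividesD => //; apply/divides_mull/divides_refl.
Qed.

(** After inverting homogeneous elements, the ideal of [f] and [x] is generated by an element [g] of
    least size. Its primitive part [g0] divides [f] in [R], so [g0] or its cofactor is homogeneous;
    then [f] divides [y] or [x] respectively. *)
Lemma primitive_prime f : f != 0 -> primitive f -> ~ homogeneous f ->
  (forall g h, f = g * h -> homogeneous g \/ homogeneous h) -> prime_elt f.
Proof.
move=> f0 pf nhf nofact; split=> // [|x y dxy].
  by apply/negP => /homogeneous_unit.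
case: (classic (divides f x)) => [|nx]; [by left|right].
pose J z := exists r s, z = f * r + x * s.
have hJ : is_ideal J.
  split; first by exists 0, 0; rewrite !mulr0 addr0.
    by move=> _ _ [r [s ->]] [r' [s' ->]]; exists (r + r'), (s + s'); ring.
  by move=> t _ [r [s ->]]; exists (t * r), (t * s); ring.
have Jf : J f by exists 1, 0; rewrite mulr1 mulr0 addr0.
have Jx : J x by exists 0, 1; rewrite mulr1 mulr0 add0r.
(* The element [f], nonzero and in [J], shows that some size is attained. *)
have [m [g [M [H [Jg hH sH]]]] min] := @ex_least
  (fun m => exists g M H, [/\ J g, homogenization M g H & size H = m])
  (let: ex_intro N (ex_intro P hP) := homogenization_exists f0 in
   ex_intro _ (size P) (ex_intro _ f (ex_intro _ N (ex_intro _ P (And3 Jf hP erefl))))).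
have {}min N v V : J v -> homogenization N v V -> (size H <= size V)%N.
  move=> Jv hV; rewrite leqNgt; apply/negP; rewrite sH => /min; apply.
  by exists v, N, V.
have dv := minimal_size_divides hJ Jg hH min.
have [a [ha a0 [h eh]]] := dv f Jf; have [a' [ha' a'0 [h' eh']]] := dv x Jx.
have [c [g0 [_ [_ [hc c0 eg pg0 _]]]]] := primitive_part hH.
have g00 : g0 != 0.
  by apply: contraNneq (homogenization_neq0 hH) => z; case: hH => hH _; rewrite eg z mulr0 => /(hom_poly_eq0 hH) ->.
have [k ek] : divides a (c * h).
  apply: (primitive_gauss ha a0 pg0); exists f.
  by rewrite eh eg; ring.
have ef : f = g0 * k.
  by apply: (mulfI a0); rewrite eh eg -mulrA mulrCA ek; ring.
(* If [g0] is homogeneous, so is [g], and [f] divides [g * y] because it divides [x * y]; [g]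
   cancels since [f] is primitive. *)
have [hg0|hk] := nofact _ _ ef.
  have ug0 := primitive_homogeneous_unit g00 pg0 hg0.
  case: Jg => r [s es].
  have hg : homogeneous g by rewrite eg; apply: homogeneousM.
  have g'0 : g != 0 by rewrite eg mulf_neq0.
  have [w ew] : divides f (g * y).
    rewrite es mulrDl; apply: dividesD; first by rewrite -mulrA; apply/divides_mulr/divides_refl.
    by rewrite -mulrA (mulrC s) mulrA; apply: divides_mulr.
  have [w' ew'] : divides g w by apply: (primitive_gauss hg g'0 pf); exists y.
  by exists w'; apply: (mulfI g'0); rewrite ew ew'; ring.
(* Otherwise the cofactor [k] is a unit, so [f] is associated to [g0], which divides [x]: a
   contradiction. *)
have k0 : k != 0 by apply: contraNneq f0 => k0; rewrite ef k0 mulr0.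
have uk : k \is a GRing.unit.
  apply: primitive_homogeneous_unit => //; apply: (primitive_divisor pf).
  by rewrite ef; apply/divides_mull/divides_refl.
case: nx; have [w ew] : divides a' (c * h').
  apply: (primitive_gauss ha' a'0 pg0); exists x; rewrite eh' eg; ring.
exists (k^-1 * w); apply: (mulfI a'0).
rewrite eh' eg ef -(mulrA g0) mulVKr // -mulrA mulrCA ew; ring.
Qed.

(* The homogeneous localization of [R] is [K0[w, 1/w]] for a field [K0], hence a
   principal ideal domain; this is Nagata's descent from it to [R]. *)
Lemma graded_factorable f : f != 0 -> factorable f.
Proof.
move=> f0; have [N [P hP]] := homogenization_exists f0.
have [k] : exists k, size P = k by exists (size P).
elim/ltn_ind: k N f P f0 hP => k IH N f P f0 hP sP.
have [c [g [M [Q [hc c0 ef pg [hQ sQ]]]]]] := primitive_part hP.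
have g0 : g != 0 by apply: contraNneq f0 => g0; rewrite ef g0 mulr0.
rewrite ef; apply: factorableM; first exact: fact.
case: (classic (homogeneous g)) => [hg|nhg]; first exact: fact.
case: (classic (forall x y, g = x * y -> homogeneous x \/ homogeneous y)) => [nf|nnf].
  by apply/factorable_prime/primitive_prime.
have [x [y [e nx ny]]] : exists x y, [/\ g = x * y, ~ homogeneous x & ~ homogeneous y].
  apply: NNPP => h; apply: nnf => x y e; apply: NNPP => /not_or_and[nx ny].
  by apply: h; exists x, y.
move: g0; rewrite e mulf_eq0 negb_or => /andP[x0 y0].
have [L [X hX]] := homogenization_exists x0; have [S [Y hY]] := homogenization_exists y0.
have := homogenizationM hX hY; rewrite -e => hXY.
have [_ eQ] := homogenization_unique hQ hXY.
(* Size at most 1 would mean homogeneous; hence both factors have smaller size than [Q] and the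
   induction applies. *)
have sX : (1 < size X)%N by rewrite ltnNge; apply/negP => /(homogenization_size1 hX).
have sY : (1 < size Y)%N by rewrite ltnNge; apply/negP => /(homogenization_size1 hY).
have sXY : size Q = (size X + size Y).-1.
  by rewrite eQ size_mul //; [exact: homogenization_neq0 hX|exact: homogenization_neq0 hY].
rewrite e; apply: factorableM.
  by apply: (IH (size X) _ _ _ _ x0 hX) => //; lia.
by apply: (IH (size Y) _ _ _ _ y0 hY) => //; lia.
Qed.

End GradedFactorial.
End Graded.

(** * Homogeneous fractions *)

Notation "x %:F" := (@FracField.tofrac _ x) (format "x %:F") : ring_scope.

Lemma fraction_div (R : idomainType) (k : {fraction R}) :
  exists x y : R, y != 0 /\ k = x%:F / y%:F.
Proof.
elim/quotW: k => r; exists (val r).1, (val r).2; split; first exact: denom_ratioP.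
have d0 : (val r).2%:F != 0 :> {fraction R} by rewrite tofrac_eq0 denom_ratioP.
apply: (mulIf d0); rewrite divfK //.
unlock FracField.tofrac; rewrite -[LHS]FracField.pi_mul; apply/eqmodP => /=.
by rewrite FracField.equivfE /FracField.mulf !numden_Ratio ?mulr1 ?oner_neq0 ?mulf_neq0 ?denom_ratioP // mulrC.
Qed.

Definition subfield (K : fieldType) (F : K -> Prop) :=
  [/\ F 1, (forall x y, F x -> F y -> F (x - y)), (forall x y, F x -> F y -> F (x * y))
    & forall x, F x -> F x^-1].

Lemma subf_div (K : fieldType) (x y z t : K) : y != 0 -> t != 0 ->
  x / y - z / t = (x * t - z * y) / (y * t).
Proof. by move=> y0 t0; rewrite -mulNr addf_div // mulNr. Qed.

(** * Extension of an injective morphism to the fraction field *)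

Section FractionMorphism.
Context {R : idomainType} {K : fieldType} (psi : {rmorphism R -> K}).
Hypothesis psi_inj : forall x, psi x = 0 -> x = 0.

Lemma inj_rmorph_neq0 x : x != 0 -> psi x != 0.
Proof. by apply: contra_neq => /psi_inj. Qed.

Definition quotients (k : K) := exists x y : R, y != 0 /\ k = psi x / psi y.

Lemma quotients_psi x : quotients (psi x).
Proof. by exists x, 1; rewrite oner_neq0 rmorph1 divr1. Qed.

Lemma subfield_quotients : subfield quotients.
Proof.
split.
- by rewrite -(rmorph1 psi); apply: quotients_psi.
- move=> _ _ [x [y [y0 ->]]] [z [t [t0 ->]]].
  exists (x * t - z * y), (y * t); rewrite mulf_neq0 // rmorphB !rmorphM; split=> //.
  by rewrite subf_div ?inj_rmorph_neq0.
- move=> _ _ [x [y [y0 ->]]] [z [t [t0 ->]]].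
  by exists (x * z), (y * t); rewrite mulf_neq0 // !rmorphM invfM mulrACA.
- move=> _ [x [y [y0 ->]]]; have [->|x0] := eqVneq x 0.
    by exists 0, 1; rewrite rmorph0 !mul0r invr0 oner_neq0.
  by exists y, x; rewrite invf_div.
Qed.

Lemma quotient_wd (x y z t : R) : y != 0 -> t != 0 ->
  x%:F / y%:F = z%:F / t%:F :> {fraction R} -> psi x / psi y = psi z / psi t.
Proof.
move=> y0 t0 /eqP; rewrite eqr_div ?tofrac_eq0 // -!tofracM tofrac_eq => /eqP e.
by apply/eqP; rewrite eqr_div ?inj_rmorph_neq0 // -!rmorphM e.
Qed.

(** The morphism uses a chosen numerator and denominator; by [quotient_wd] its values do not depend
    on the choice. *)
Lemma fraction_bijection : (forall k, quotients k) ->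
  exists phi : {rmorphism {fraction R} -> K}, bijective phi.
Proof.
move=> surj; pose num q := projT1 (constructive_indefinite_description _ (@fraction_div R q)).
have numP (q : {fraction R}) : exists y, y != 0 /\ q = (num q)%:F / y%:F.
  by rewrite /num; case: constructive_indefinite_description.
pose den q := projT1 (constructive_indefinite_description _ (numP q)).
have denP q : den q != 0 /\ q = (num q)%:F / (den q)%:F.
  by rewrite /den; case: constructive_indefinite_description.
pose f q := psi (num q) / psi (den q).
have fE x y : y != 0 -> f (x%:F / y%:F) = psi x / psi y.
  by move=> y0; have [d0 e] := denP (x%:F / y%:F); apply: quotient_wd.
have fB : {morph f : p q / p - q}.
  move=> p q; have [x [y [y0 ->]]] := fraction_div p.
  have [z [t [t0 ->]]] := fraction_div q.
  have -> : x%:F / y%:F - z%:F / t%:F = (x * t - z * y)%:F / (y * t)%:F :> {fraction R}.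
    by rewrite tofracB !tofracM subf_div ?tofrac_eq0.
  by rewrite !fE ?mulf_neq0 // rmorphB !rmorphM subf_div ?inj_rmorph_neq0.
have fM : monoid_morphism f.
  split.
    have -> : 1 = 1%:F / 1%:F :> {fraction R} by rewrite divr1.
    by rewrite fE ?oner_neq0 // rmorph1 divr1.
  move=> p q; have [x [y [y0 ->]]] := fraction_div p.
  have [z [t [t0 ->]]] := fraction_div q.
  have -> : x%:F / y%:F * (z%:F / t%:F) = (x * z)%:F / (y * t)%:F :> {fraction R}.
    by rewrite !tofracM invfM mulrACA.
  by rewrite !fE ?mulf_neq0 // !rmorphM invfM mulrACA.
pose phi : {rmorphism {fraction R} -> K} :=
  HB.pack f (GRing.isZmodMorphism.Build _ _ f fB) (GRing.isMonoidMorphism.Build _ _ f fM).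
have phi_surj k : exists q, phi q == k.
  by have [x [y [y0 ->]]] := surj k; exists (x%:F / y%:F); apply/eqP/fE.
exists phi; exists (fun k => xchoose (phi_surj k)) => [q|k].
  by apply: (fmorph_inj phi); apply/eqP/(xchooseP (phi_surj (phi q))).
by apply/eqP/(xchooseP (phi_surj k)).
Qed.

End FractionMorphism.

(** * Degrees in the fraction field and twisted evaluations *)

Section HomogeneousFractions.
Context (A : idomainType) (G : int -> A -> Prop).
Hypothesis hG : is_Zgrading G.
Local Notation K := {fraction A}.
Implicit Types (k l : K) (m d e : int).

Definition hfrac m k := exists (x s : A) (j : int),
  [/\ s != 0, G j s, G (m + j) x & k = x%:F / s%:F].

Lemma hfrac_tofrac m x : G m x -> hfrac m x%:F.
Proof.
move=> gx; exists x, 1, 0; rewrite oner_neq0 divr1 addr0; split=> //; exact: gr1.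
Qed.

Lemma hfrac0 m : hfrac m 0.
Proof. by rewrite -tofrac0; apply: hfrac_tofrac; apply: gr0. Qed.

Lemma hfrac1 : hfrac 0 1.
Proof. by rewrite -tofrac1; apply: hfrac_tofrac; apply: gr1. Qed.

Lemma hfracM m d k l : hfrac m k -> hfrac d l -> hfrac (m + d) (k * l).
Proof.
move=> [x [s [j [s0 gs gx ->]]]] [y [t [i [t0 gt gy ->]]]].
exists (x * y), (s * t), (j + i); rewrite mulf_neq0 //; split=> //; first exact: grM.
  by rewrite addrACA; apply: grM.
by rewrite !tofracM invfM mulrACA.
Qed.

Lemma hfracN m k : hfrac m k -> hfrac m (- k).
Proof.
move=> [x [s [j [s0 gs gx ->]]]]; exists (- x), s, j; split=> //; first exact: grN.
by rewrite tofracN mulNr.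
Qed.

Lemma hfracB m k l : hfrac m k -> hfrac m l -> hfrac m (k - l).
Proof.
move=> [x [s [j [s0 gs gx ->]]]] [y [t [i [t0 gt gy ->]]]].
exists (x * t - y * s), (s * t), (j + i); rewrite mulf_neq0 //; split=> //; first exact: grM.
  apply: grB => //; first by rewrite addrA; apply: grM.
  by rewrite (addrC j) addrA; apply: grM.
by rewrite tofracB !tofracM subf_div ?tofrac_eq0.
Qed.

Lemma hfracV m k : hfrac m k -> hfrac (- m) k^-1.
Proof.
move=> [x [s [j [s0 gs gx ->]]]]; have [->|x0] := eqVneq x 0.
  by rewrite tofrac0 mul0r invr0; apply: hfrac0.
by exists s, x, (m + j); rewrite addKr invf_div.
Qed.

Lemma hfracX m k (i : nat) : hfrac m k -> hfrac (m * i%:Z) (k ^+ i).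
Proof.
move=> hk; elim: i => [|i IH]; first by rewrite mulr0; apply: hfrac1.
by rewrite intS mulrDr mulr1 exprS; apply: hfracM.
Qed.

Lemma hfracXz m k (i : int) : hfrac m k -> hfrac (m * i) (k ^ i).
Proof.
case: i => i hk; first exact: hfracX.
by rewrite NegzE mulrN -exprnN; apply/hfracV/hfracX.
Qed.

(** The numerators form a family on all of [I], homogeneous even outside [r], as [gr_components]
    expects. *)
Lemma hfrac_common_denominator (I : eqType) (r : seq I) (deg : I -> int) (k : I -> K) :
  (forall i, hfrac (deg i) (k i)) ->
  exists (t : A) (j : int) (g : I -> A), [/\ t != 0, G j t,
    (forall i, G (deg i + j) (g i)) & forall i, i \in r -> k i * t%:F = (g i)%:F].
Proof.
move=> hk; elim: r => [|i0 r [t [j [g [t0 gt hg eg]]]]].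
  by exists 1, 0, (fun=> 0); rewrite oner_neq0; split=> // [|i]; [exact: gr1|exact: gr0].
have [x [s [i [s0 gs gx ek]]]] := hk i0.
exists (t * s), (j + i), (fun l : I => if l == i0 then x * t else g l * s).
split; [exact: mulf_neq0|exact: grM|move=> l|move=> l].
  case: eqP => [->|_]; first by rewrite (addrC j) addrA; apply: grM.
  by rewrite addrA; apply: grM.
rewrite inE; case: eqP => [-> _|_ /= lr].
  by rewrite ek !tofracM (mulrC t%:F) mulrA divfK ?tofrac_eq0.
by rewrite !tofracM mulrA eg.
Qed.

Lemma hfrac_components (I : eqType) (r : seq I) (deg : I -> int) (k : I -> K) :
  (forall i, hfrac (deg i) (k i)) -> \sum_(i <- r) k i = 0 ->
  forall d, \sum_(i <- r | deg i == d) k i = 0.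
Proof.
move=> hk sk d; have [t [j [g [t0 _ hg eg]]]] := hfrac_common_denominator r hk.
have t1 : t%:F != 0 :> K by rewrite tofrac_eq0.
have clear (S : pred I) : (\sum_(i <- r | S i) k i) * t%:F = (\sum_(i <- r | S i) g i)%:F.
  rewrite mulr_suml rmorph_sum /= big_seq_cond [RHS]big_seq_cond.
  by apply: eq_bigr => i /andP[/eg].
have sg : \sum_(i <- r) g i = 0.
  by apply/eqP; rewrite -tofrac_eq0 -clear sk mul0r.
apply: (mulIf t1); rewrite clear mul0r.
rewrite (eq_bigl (fun i => deg i + j == d + j)) => [|i].
  by rewrite (gr_components hG hg sg (d + j)) tofrac0.
by rewrite (inj_eq (addIr j)).
Qed.

(** If [P] homogenizes [x] with shift [N], evaluating [P] at [rho] instead of 1 and dividing by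
    [rho ^ N] multiplies the component of degree [i] by [rho ^ i]. Differences require a common
    shift; in products the shifts add up. *)
Lemma twist_exists (rho : K) : rho != 0 ->
  exists sigma : {rmorphism A -> K}, forall i x, G i x -> sigma x = x%:F * rho ^ i.
Proof.
move=> r0.
pose tau := map_poly (@FracField.tofrac A).
pose val N (P : {poly A}) := (tau P).[rho] * rho ^ (- N).
have val_shift N (k : nat) P : val (N + k%:Z) (P * 'X^k) = val N P.
  rewrite /val /tau rmorphM /= map_polyXn !hornerE opprD expfzDr // mulrACA.
  by rewrite (exprnP rho k) -expfzDr // subrr expr0z mulr1.
have valE N M P Q : hom_poly G N P -> hom_poly G M Q -> P.[1] = Q.[1] -> val N P = val M Q.
  wlog le : N M P Q / (N <= M)%R => [H hP hQ e|hP hQ e].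
    by have [/H|/ltW /H h] := lerP N M; [exact|rewrite (h _ _ hQ hP)].
  by have [k -> <-] := hom_poly_unique hG hP hQ e le; rewrite val_shift.
pose rep x (v : int * {poly A}) := hom_poly G v.1 v.2 /\ v.2.[1] = x.
have rep_ex x : exists v, rep x v.
  by have [N [P hP]] := hom_poly_exists hG x; exists (N, P).
pose f x := let v := projT1 (constructive_indefinite_description _ (rep_ex x)) in val v.1 v.2.
have fE N P : hom_poly G N P -> f P.[1] = val N P.
  rewrite /f; case: constructive_indefinite_description => -[M Q] [/= hQ e] hP.
  exact: valE.
have fB : {morph f : x y / x - y}.
  move=> x y; have [N [P [hP <-]]] := hom_poly_exists hG x.
  have [M [Q [hQ <-]]] := hom_poly_exists hG y.
  have [k [l e]] : exists k l : nat, N + k%:Z = M + l%:Z.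
    by exists (absz (`|N| + `|M| - N)), (absz (`|N| + `|M| - M)); lia.
  rewrite (fE _ _ hP) (fE _ _ hQ) -(val_shift N k) -(val_shift M l).
  have h1 := hom_poly_shift hG k hP; have h2 := hom_poly_shift hG l hQ.
  rewrite -e in h2 *.
  have -> : P.[1] - Q.[1] = (P * 'X^k - Q * 'X^l).[1] by rewrite !hornerE !expr1n !mulr1.
  rewrite (fE _ _ (hom_polyB hG h1 h2)) /val -mulrBl; congr (_ * _).
  by rewrite /tau rmorphB hornerD hornerN.
have fM : monoid_morphism f.
  split.
    have h : hom_poly G 0 1 by move=> i; rewrite coef1; case: i => [|i]; [exact: gr1|exact: gr0].
    have -> : 1 = (1 : {poly A}).[1] by rewrite hornerE.
    by rewrite (fE _ _ h) /val /tau rmorph1 hornerC mul1r oppr0 expr0z.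
  move=> x y; have [N [P [hP <-]]] := hom_poly_exists hG x.
  have [M [Q [hQ <-]]] := hom_poly_exists hG y.
  rewrite -hornerM (fE _ _ (hom_polyM hG hP hQ)) (fE _ _ hP) (fE _ _ hQ) /val /tau.
  by rewrite rmorphM hornerM opprD expfzDr // mulrACA.
pose sigma : {rmorphism A -> K} :=
  HB.pack f (GRing.isZmodMorphism.Build _ _ f fB) (GRing.isMonoidMorphism.Build _ _ f fM).
exists sigma => i x gx; rewrite /sigma /=.
have h : hom_poly G (- i) x%:P.
  move=> [|j]; rewrite coefC /=; last exact: gr0.
  by rewrite sub0r opprK.
by rewrite -[x in f x](hornerC x 1) (fE _ _ h) /val /tau map_polyC hornerC opprK.
Qed.

Lemma twisted_evaluation_exists (rho zeta : K) : rho != 0 ->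
  exists phi : {rmorphism {poly A} -> K},
    (forall i x, G i x -> phi x%:P = x%:F * rho ^ i) /\ phi 'X = zeta.
Proof.
move=> /twist_exists[sigma hs].
pose phi : {rmorphism {poly A} -> K} := horner_eval zeta \o map_poly sigma.
exists phi; split=> [i x gx|]; rewrite /phi /= /horner_eval.
  by rewrite map_polyC hornerC; apply: hs.
by rewrite map_polyX hornerX.
Qed.

End HomogeneousFractions.

(** * Choice of the twist *)

Section Normalization.
Context (A : idomainType) (G : int -> A -> Prop).
Hypothesis hG : is_Zgrading G.
Local Notation K := {fraction A}.

Lemma regrade (e : int) : e != 0 ->
  (forall d x, G d x -> x != 0 -> (e %| d)%Z) -> is_Zgrading (fun d => G (e * d)).
Proof.
move=> e0 he; have [g0 gB gM dec ind] := hG; split.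
- by move=> d; apply: g0.
- by move=> d; apply: gB.
- by move=> i j x y; rewrite mulrDr; apply: gM.
- move=> x; have [s [f [us hf ->]]] := dec x.
  pose s' := [seq d <- s | (e %| d)%Z].
  exists [seq (d %/ e)%Z | d <- s'], (fun d => f (e * d)); split=> //.
    rewrite map_inj_in_uniq ?filter_uniq // => d d'.
    rewrite !mem_filter => /andP[hd _] /andP[hd' _] eq.
    by rewrite -(divzK hd) -(divzK hd') eq.
  rewrite big_map big_filter [RHS]big_mkcond; apply: eq_bigr => d _.
  case: ifP => [/divzK|nd]; first by rewrite mulrC => ->.
  by apply/eqP; apply: contraFT nd => /(he _ _ (hf d)).
- move=> s f us hf sf d ds.
  pose f' d := if (e %| d)%Z then f (d %/ e)%Z else 0.
  have hf' i : G i (f' i).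
    rewrite /f'; case: ifP => [/divzK hi|_]; last exact: g0.
    by have := hf (i %/ e)%Z; rewrite mulrC hi.
  have ef' i : f' (e * i) = f i by rewrite /f' dvdz_mulr // mulKz.
  rewrite -ef'; apply: (ind [seq e * i | i <- s] f') => //.
  + by rewrite map_inj_uniq //; apply: mulfI.
  + by rewrite big_map; under eq_bigr do rewrite ef'.
  + exact: map_f.
Qed.

(** The degrees of nonzero homogeneous fractions form a subgroup of the integers, and [e] is its
    least positive element; a fraction of degree [e] gets degree 1 in the new grading. *)
Lemma normalized_grading : (forall d x, G d x -> x != 0 -> d = 0) \/
  exists e, [/\ e != 0, is_Zgrading (fun d => G (e * d)),
    (forall d x, G d x -> x != 0 -> (e %| d)%Z)
    & exists y, y != 0 /\ hfrac (fun d => G (e * d)) 1 y].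
Proof.
pose D m := exists k : K, k != 0 /\ hfrac G m k.
have [[m [m0 Dm]]|none] := classic (exists m, m <> 0 /\ D m); last first.
  left=> d x gx x0; apply: NNPP => d0; apply: none; exists d; split=> //.
  by exists x%:F; rewrite tofrac_eq0; split=> //; apply: hfrac_tofrac.
right.
have [e [e0 [y [y0 hy]]] min] : exists2 e : nat, (0 < e)%N /\ D e%:Z &
    forall i, (i < e)%N -> ~ ((0 < i)%N /\ D i%:Z).
  apply: (@ex_least (fun e : nat => (0 < e)%N /\ D e%:Z)); exists `|m|%N; split; first by lia.
  have [m1|m1] : `|m|%N%:Z = m \/ `|m|%N%:Z = - m by lia.
    by rewrite m1.
  have [k [k0 hk]] := Dm; exists k^-1; rewrite invr_eq0 m1; split=> //.
  exact: hfracV.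
have div d x : G d x -> x != 0 -> (e%:Z %| d)%Z.
  move=> gx x0; apply: NNPP => nd.
  have lt : (d %% e%:Z)%Z < e%:Z by apply: ltz_pmod; lia.
  have ge : 0 <= (d %% e%:Z)%Z by apply: modz_ge0; lia.
  apply: (min `|(d %% e%:Z)%Z|%N); first by lia.
  have nz : (d %% e%:Z)%Z != 0 by apply/eqP => /dvdz_mod0P.
  split; first by lia.
  have -> : `|(d %% e%:Z)%Z|%N%:Z = (d %% e%:Z)%Z by lia.
  (* The remainder of [d] modulo [e] is again the degree of a nonzero fraction, against the
     minimality of [e]. *)
  exists (x%:F * y ^ (- (d %/ e%:Z)%Z)); split.
    by rewrite mulf_neq0 ?tofrac_eq0 // expfz_neq0.
  have -> : (d %% e%:Z)%Z = d + e%:Z * - (d %/ e%:Z)%Z.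
    by rewrite {2}(divz_eq d e%:Z) mulrN (mulrC e%:Z) addrC addKr.
  by apply: hfracM => //; [apply: hfrac_tofrac|apply: hfracXz].
have e1 : e%:Z != 0 by lia.
exists e%:Z; split=> //; first exact: regrade.
exists y; split=> //; have [x [s [j [s0 gs gx ey]]]] := hy.
exists x, s, (j %/ e%:Z)%Z; have hj := divzK (div _ _ gs s0).
by split; rewrite // ?mulrDr ?mulr1 mulrC hj.
Qed.

End Normalization.

(** By [u * n = 1 - v * d], both sides equal [y ^ (d * n) * c ^ (u * n)]. *)
Lemma twisting_exponents (F : fieldType) (y c : F) (n d u v : int) :
  y != 0 -> c != 0 -> u * n + v * d = 1 ->
  c * y ^ d * (y ^ (n - 1) * c ^ (- v)) ^ d = (y ^ d * c ^ u) ^ n.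
Proof.
move=> y0 c0 uv; rewrite !expfzMl !exprz_exp (mulrC c) mulrACA -expfzDr //.
have -> : d + (n - 1) * d = d * n by ring.
have -> : u * n = 1 + - v * d by rewrite -uv; ring.
by rewrite expfzDr // expr1z.
Qed.

Section Twisting.
Context (A : idomainType) (G : int -> A -> Prop) (a b : A) (n : nat) (da db : int).
Hypothesis hG : is_Zgrading G.
Hypotheses (a0 : a != 0) (b0 : b != 0) (ga : G da a) (gb : G db b).
Hypotheses (n_gt0 : (0 < n)%N) (co : gcdz n%:Z (db - da) = 1).
Local Notation K := {fraction A}.
Local Notation d := (db - da).

(* Exactly what makes the evaluation [x |-> x * rho ^ i] ([x] of degree [i]), ['X |-> zeta]
   kill [a 'X^n - b] and multiply degrees by [n]. *)
Definition twisting_pair (rho zeta : K) :=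
  [/\ rho != 0, zeta != 0, hfrac G (n%:Z - 1) rho, hfrac G d zeta &
      b%:F * rho ^ db = a%:F * rho ^ da * zeta ^+ n].

(** States that [rho] lies in the subfield generated by the values of the twisted evaluation;
    dividing by powers of [rho] then recovers [A], so the quotient ring has fraction field [K]. *)
Definition twisting_generates (rho zeta : K) :=
  forall F, subfield F -> (forall i x, G i x -> F (x%:F * rho ^ i)) -> F zeta -> F rho.

Lemma subfieldXz (F : K -> Prop) x i : subfield F -> F x -> F (x ^ i).
Proof.
move=> [F1 _ FM FV] Fx.
have FX (k : nat) : F (x ^+ k) by elim: k => [|k IH]; rewrite ?exprS //; apply: FM.
by case: i => k; [apply: FX|rewrite NegzE -exprnN; apply/FV/FX].
Qed.

Lemma twisting_relation (rho zeta : K) : rho != 0 ->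
  b%:F / a%:F * rho ^ d = zeta ^+ n -> b%:F * rho ^ db = a%:F * rho ^ da * zeta ^+ n.
Proof.
move=> r0 <-; have a1 : a%:F != 0 :> K by rewrite tofrac_eq0.
have -> : rho ^ db = rho ^ da * rho ^ d by rewrite -expfzDr // addrC subrK.
have -> : a%:F * rho ^ da * (b%:F / a%:F * rho ^ d) =
   a%:F * (b%:F / a%:F) * (rho ^ da * rho ^ d) by rewrite mulrACA.
by rewrite (mulrCA a%:F) divff // mulr1.
Qed.

Lemma hfrac_ba : hfrac G d (b%:F / a%:F).
Proof. by apply: hfracM => //; [|apply: hfracV => //]; apply: hfrac_tofrac. Qed.

Lemma twisting_pair_exists :
  (forall m x, G m x -> x != 0 -> m = 0) \/ (exists y, y != 0 /\ hfrac G 1 y) ->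
  exists rho zeta, twisting_pair rho zeta /\ twisting_generates rho zeta.
Proof.
have ba0 : b%:F / a%:F != 0 :> K by rewrite mulf_neq0 ?invr_eq0 ?tofrac_eq0.
case=> [triv|[y [y0 hy]]].
  (* With all degrees 0, the gcd condition forces [n = 1], and the untwisted evaluation at [b / a]
     will do. *)
  have da0 := triv _ _ ga a0; have db0 := triv _ _ gb b0.
  have n1 : n = 1%N by move: co; rewrite da0 db0 subrr gcdz0 /=; lia.
  exists 1, (b%:F / a%:F); split; last by move=> F [].
  split; rewrite ?oner_neq0 //; first by rewrite n1 subrr; apply: hfrac1.
    exact: hfrac_ba.
  by apply: twisting_relation; rewrite ?oner_neq0 // exp1rz n1 mulr1 expr1.
have [u [v]] := Bezoutz n%:Z d; rewrite co => uv.
pose c0 : K := b%:F / a%:F * y ^ (- d).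
have c0n : c0 != 0 := mulf_neq0 ba0 (expfz_neq0 _ y0).
have hc0 : hfrac G 0 c0.
  have -> : 0 = d + 1 * (- d) by rewrite mul1r subrr.
  by apply: hfracM => //; [apply: hfrac_ba|apply: hfracXz].
pose rho := y ^ (n%:Z - 1) * c0 ^ (- v); pose zeta := y ^ d * c0 ^ u.
have r0 : rho != 0 := mulf_neq0 (expfz_neq0 _ y0) (expfz_neq0 _ c0n).
have z0 : zeta != 0 := mulf_neq0 (expfz_neq0 _ y0) (expfz_neq0 _ c0n).
have hrho : hfrac G (n%:Z - 1) rho.
  have -> : n%:Z - 1 = 1 * (n%:Z - 1) + 0 * (- v) by rewrite mul0r mul1r addr0.
  by apply: hfracM => //; apply: hfracXz.
have hzeta : hfrac G d zeta.
  have -> : d = 1 * d + 0 * u by rewrite mul0r mul1r addr0.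
  by apply: hfracM => //; apply: hfracXz.
exists rho, zeta; split.
  split=> //; apply: twisting_relation => //.
  have -> : b%:F / a%:F = c0 * y ^ d.
    by rewrite /c0 -mulrA -expfzDr // addNr expr0z mulr1.
  exact: (twisting_exponents y0 c0n uv).
move=> F hF FG Fz; have [F1 FB FM FV] := hF.
(* The twisted values of numerator and denominator lie in [F], and their quotient is twisted by
   [rho ^ m]. *)
have FH m k : hfrac G m k -> F (k * rho ^ m).
  move=> [x [s [j [s0 gs gx ->]]]].
  have -> : x%:F / s%:F * rho ^ m = (x%:F * rho ^ (m + j)) * (s%:F * rho ^ j)^-1.
    rewrite expfzDr // invfM mulrACA; congr (_ * _).
    by rewrite (mulfK (expfz_neq0 _ r0)).
  by apply: FM; [|apply: FV]; apply: FG.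
(* [w] has degree [u n + v d = 1], which reaches [rho] from degree 0. *)
pose w := (y * rho) ^ u * zeta ^ v.
have Fw : F w.
  by apply: FM; apply: subfieldXz => //; rewrite -[rho in y * rho]expr1z; apply: FH.
have w0 : w != 0 := mulf_neq0 (expfz_neq0 _ (mulf_neq0 y0 r0)) (expfz_neq0 _ z0).
have hw : hfrac G 1 w.
  have -> : 1 = (1 + (n%:Z - 1)) * u + d * v by rewrite -uv; lia.
  apply: hfracM => //; apply: hfracXz => //; exact: hfracM.
(* The factor [rho * w ^ (- (n - 1))] has degree 0, so the twist leaves it unchanged and it lies in
   [F]. *)
have -> : rho = (rho * w ^ (- (n%:Z - 1))) * rho ^ 0 * w ^ (n%:Z - 1).
  by rewrite expr0z mulr1 -mulrA -expfzDr // addNr expr0z mulr1.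
apply: FM; last exact: subfieldXz.
apply: FH; have -> : 0 = (n%:Z - 1) + 1 * (- (n%:Z - 1)) by rewrite mul1r subrr.
by apply: hfracM => //; apply: hfracXz.
Qed.

End Twisting.

(** * The kernel of the twisted evaluation *)

Lemma poly_scale_divides (R : idomainType) (c : R) (q : {poly R}) :
  (forall i, divides c q`_i) -> exists q', q = c *: q'.
Proof.
elim/poly_ind: q => [|q e IH] h; first by exists 0; rewrite scaler0.
have [i|q' ->] := IH; first by have := h i.+1; rewrite coefD coefMX coefC /= addr0.
have [e' ee] : divides c e by have := h 0%N; rewrite coefD coefMX coefC /= add0r.
by exists (q' * 'X + e'%:P); rewrite scalerDr scalerAl ee polyCM mul_polyC.
Qed.

(** * Decomposition of polynomials into homogeneous monomials *)

Section CommonHomogenization.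
Context (A : idomainType) (G : int -> A -> Prop).
Hypothesis hG : is_Zgrading G.

Lemma common_hom_poly (m : nat) (r : nat -> A) : exists N (P : nat -> {poly A}),
  (forall j, hom_poly G N (P j)) /\ forall j, (j < m)%N -> (P j).[1] = r j.
Proof.
elim: m => [|m [N [P [hP eP]]]].
  by exists 0, (fun=> 0); split=> // j i; rewrite coef0; apply: gr0.
have [M [Q [hQ eQ]]] := hom_poly_exists hG (r m).
have [k [l e]] : exists k l : nat, N + k%:Z = M + l%:Z.
  by exists (absz (`|N| + `|M| - N)), (absz (`|N| + `|M| - M)); lia.
exists (N + k%:Z), (fun j => if j == m then Q * 'X^l else P j * 'X^k); split=> j.
  by case: eqP => _; [rewrite e|]; apply: hom_poly_shift.
rewrite ltnS leq_eqVlt; case: eqP => [-> _|_ /= jm]; rewrite hornerM hornerXn expr1n mulr1.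
  exact: eQ.
exact: eP.
Qed.

(** A common shift for all coefficients lets the monomials be indexed by pairs of a degree and an
    exponent without repetition. *)
Lemma monomial_decomposition (m : nat) (r : {poly A}) : (size r <= m)%N ->
  exists (I : finType) (i : I -> int) (x : I -> A) (j : I -> nat),
    [/\ forall p q, i p = i q -> j p = j q -> p = q, forall p, (j p < m)%N,
      forall p, G (i p) (x p) & r = \sum_p (x p)%:P * 'X^(j p)].
Proof.
move=> sr; have [N [P [hP eP]]] := common_hom_poly m (fun j => r`_j).
pose S := \max_(j < m) size (P j).
exists ('I_S * 'I_m)%type, (fun p : 'I_S * 'I_m => p.1%:Z - N),
  (fun p : 'I_S * 'I_m => (P p.2)`_(p.1)), (fun p : 'I_S * 'I_m => p.2 : nat); split=> [[i j] [i' j'] /= ei ej|p|p|]; last 1 first.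
- rewrite -(pair_bigA _ (fun (i : 'I_S) (j : 'I_m) => ((P j)`_i)%:P * 'X^j)) exchange_big /=.
  have -> : r = \poly_(j < m) r`_j.
    apply/polyP => j; rewrite coef_poly; case: ltnP => // nj.
    by rewrite nth_default // (leq_trans sr).
  rewrite poly_def; apply: eq_bigr => j _.
  have sP : (size (P j) <= S)%N by apply: (leq_bigmax_cond (F := fun j : 'I_m => size (P j))).
  rewrite -mulr_suml -eP // (horner_coef_wide _ sP) -mul_polyC rmorph_sum /=.
  by congr (_ * _); apply: eq_bigr => i _; rewrite expr1n mulr1.
- by congr (_, _); apply: val_inj => //=; lia.
- exact: ltn_ord.
- exact: hP.
Qed.

End CommonHomogenization.

Section Kummer.
Context (A : idomainType) (G : int -> A -> Prop) (a b : A) (n : nat) (da db : int).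
Hypothesis hG : is_Zgrading G.
Hypotheses (a0 : a != 0) (b0 : b != 0) (ga : G da a) (gb : G db b).
Hypothesis cop : forall x, divides a x /\ divides b x <-> divides (a * b) x.
Hypotheses (n_gt0 : (0 < n)%N) (co : gcdz n%:Z (db - da) = 1).
Local Notation K := {fraction A}.
Local Notation d := (db - da).
Local Notation relation := (a%:P * 'X^n - b%:P : {poly A}).
Context (rho zeta : K) (phi : {rmorphism {poly A} -> K}).
Hypothesis tw : twisting_pair G a b n da db rho zeta.
Hypothesis phiC : forall i x, G i x -> phi x%:P = x%:F * rho ^ i.
Hypothesis phiX : phi 'X = zeta.

Lemma phi_monomial i x (j : nat) : G i x -> phi (x%:P * 'X^j) = x%:F * rho ^ i * zeta ^+ j.
Proof. by move=> gx; rewrite rmorphM rmorphXn phiX (phiC gx). Qed.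

Lemma hfrac_monomial i x (j : nat) : G i x ->
  hfrac G (n%:Z * i + d * j%:Z) (phi (x%:P * 'X^j)).
Proof.
move=> gx; rewrite (phi_monomial j gx); case: tw => _ _ hr hz _.
have -> : n%:Z * i + d * j%:Z = i + (n%:Z - 1) * i + d * j%:Z by ring.
apply: hfracM => //; last exact: hfracX.
by apply: hfracM => //; [apply: hfrac_tofrac|apply: hfracXz].
Qed.

Lemma phi_monomial_eq0 i x (j : nat) : G i x -> phi (x%:P * 'X^j) = 0 -> x = 0.
Proof.
case: tw => r0 z0 _ _ _ gx; rewrite (phi_monomial j gx) => /eqP.
rewrite !mulf_eq0 tofrac_eq0 (negbTE (expfz_neq0 _ r0)) (negbTE (expf_neq0 _ z0)) !orbF.
by move/eqP.
Qed.

(** [n] divides [d * (j - j')], hence [j - j'], which is smaller than [n] in absolute value. *)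
Lemma degree_injective (i i' : int) (j j' : nat) : (j < n)%N -> (j' < n)%N ->
  n%:Z * i + d * j%:Z = n%:Z * i' + d * j'%:Z -> i = i' /\ j = j'.
Proof.
move=> jn jn' e; have cn : coprimez n%:Z d by rewrite /coprimez co.
have : (n%:Z %| d * (j%:Z - j'%:Z))%Z.
  by apply/dvdzP; exists (i' - i); rewrite mulrBr mulrC mulrBr; lia.
rewrite Gauss_dvdzr // => /dvdzP[q eq].
have q0 : q = 0.
  by have [hq|hq|//] := ltgtP q 0; nia.
have ej : j = j' by move: eq; rewrite q0; lia.
split=> //; move: e; rewrite ej => /addIr /mulfI; apply; lia.
Qed.

Lemma small_decomposition (r : {poly A}) : (size r <= n)%N ->
  exists (I : finType) (T : I -> {poly A}) (deg : I -> int),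
    [/\ injective deg, r = \sum_p T p & forall p, exists i x (j : nat),
      [/\ (j < n)%N, G i x, T p = x%:P * 'X^j & deg p = n%:Z * i + d * j%:Z]].
Proof.
move=> /(monomial_decomposition hG)[I [i [x [j [inj jn gx er]]]]].
exists I, (fun p => (x p)%:P * 'X^(j p)), (fun p => n%:Z * i p + d * (j p)%:Z); split=> //.
  by move=> p q /degree_injective[] // *; apply: inj.
by move=> p; exists (i p), (x p), (j p).
Qed.

(** For exponents below [n] the monomials land in distinct degrees of [K], so a vanishing sum has
    vanishing terms. *)
Lemma phi_small_eq0 (r : {poly A}) : (size r <= n)%N -> phi r = 0 -> r = 0.
Proof.
move=> sr pr; have [I [T [deg [inj er hT]]]] := small_decomposition sr.
have hd p : hfrac G (deg p) (phi (T p)).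
  by have [i [x [j [_ gx -> ->]]]] := hT p; apply: hfrac_monomial.
have sum0 : \sum_p phi (T p) = 0 by rewrite -rmorph_sum -er.
rewrite er big1 // => p _; have := hfrac_components hG hd sum0 (deg p).
rewrite (big_pred1 p) => [|q]; last by rewrite (inj_eq inj).
have [i [x [j [_ gx -> _]]]] := hT p.
by move=> /(phi_monomial_eq0 gx) ->; rewrite polyC0 mul0r.
Qed.

Lemma small_homogeneous (r : {poly A}) m : (size r <= n)%N -> hfrac G m (phi r) ->
  exists i x (j : nat), G i x /\ r = x%:P * 'X^j.
Proof.
move=> sr hr; have [I [T [deg [inj er hT]]]] := small_decomposition sr.
(* The extra index [None] carries [- phi r] in degree [m]: the family sums to zero, and its part of
   degree [m] compares [phi r] with at most one monomial. *)
have hd (o : option I) : hfrac G (if o is Some p then deg p else m)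
    (if o is Some p then phi (T p) else - phi r).
  case: o => [p|]; last exact: hfracN.
  by have [i [x [j [_ gx -> ->]]]] := hT p; apply: hfrac_monomial.
have sum0 : \sum_(o <- None :: [seq Some p | p <- index_enum I])
    (if o is Some p then phi (T p) else - phi r) = 0.
  by rewrite big_cons big_map -rmorph_sum -er addNr.
have := hfrac_components hG hd sum0 m; rewrite big_cons eqxx big_map.
case: (pickP (fun p => deg p == m)) => [p /eqP ep|none].
  rewrite (big_pred1 p) => [|q]; last by rewrite -ep (inj_eq inj).
  have [i [x [j [jn gx eT _]]]] := hT p; rewrite eT addrC => /eqP.
  rewrite subr_eq0 -subr_eq0 -rmorphB => /eqP e.
  exists i, x, j; split=> //; apply/eqP; rewrite eq_sym -subr_eq0; apply/eqP.
  apply: phi_small_eq0 e; apply: (leq_trans (size_polyD _ _)).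
  rewrite size_polyN geq_max sr andbT mul_polyC (leq_trans (size_scale_leq _ _)) //.
  by rewrite size_polyXn.
rewrite big_pred0 // addr0 => /eqP; rewrite oppr_eq0 => /eqP /(phi_small_eq0 sr) ->.
by exists 0, 0, 0%N; split; [apply: gr0|rewrite polyC0 mul0r].
Qed.

Lemma size_relation : size relation = n.+1.
Proof.
rewrite size_polyDl mul_polyC size_scale // size_polyXn // size_polyN.
by rewrite (leq_ltn_trans (size_polyC_leq1 b)).
Qed.

Lemma lead_coef_relation : lead_coef relation = a.
Proof.
rewrite lead_coefE size_relation /= coefB coefCM coefXn eqxx mulr1 coefC.
by rewrite -[n == 0%N]negbK -lt0n n_gt0 subr0.
Qed.

Lemma pseudo_division (f : {poly A}) : exists N (q r : {poly A}),
  (size r <= n)%N /\ a ^+ N *: f = q * relation + r.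
Proof.
exists (scalp f relation), (f %/ relation), (f %% relation); split.
  by rewrite -ltnS -size_relation ltn_modp -size_poly_eq0 size_relation.
by rewrite -Pdiv.Idomain.divp_eq lead_coef_relation.
Qed.

Lemma phi_relation : phi relation = 0.
Proof.
case: tw => _ _ _ _ e.
by rewrite rmorphB (phi_monomial n ga) (phiC gb) e subrr.
Qed.

(* Since [a, b] are coprime, [a] stays cancellable modulo [a 'X^n - b]. *)
Lemma relation_cancel_a (f : {poly A}) : divides relation (a *: f) -> divides relation f.
Proof.
move=> [q e]; have [i|q' eq] := @poly_scale_divides A a q.
  (* [b] times a coefficient of [q] is a multiple of both [a] and [b], hence of [a * b]; so [a]
     divides every coefficient of [q]. *)
  have eb : b * q`_i = a * ((q * 'X^n)`_i - f`_i).
    have eq : a *: f = a *: (q * 'X^n) - b *: q by rewrite e -!mul_polyC; ring.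
    have := congr1 (fun p : {poly A} => p`_i) eq.
    by rewrite coefB !coefZ mulrBr => ->; ring.
  have /cop[c ec] : divides a (b * q`_i) /\ divides b (b * q`_i).
    by split; [rewrite eb|]; apply/divides_mulr/divides_refl.
  by exists c; apply: (mulfI b0); rewrite ec; ring.
have aP : a%:P != 0 by rewrite polyC_eq0.
by exists q'; apply: (mulfI aP); rewrite [LHS]mul_polyC e eq -[a *: q']mul_polyC mulrCA.
Qed.

(** Pseudo-division leaves a remainder of small size in the kernel, hence zero; the power of [a] it
    introduces is cancelled modulo the relation. *)
Lemma phi_kernel (f : {poly A}) : phi f = 0 <-> pideal relation f.
Proof.
split=> [pf|[q ->]]; last by rewrite rmorphM phi_relation mul0r.
have [N [q [r [sr e]]]] := pseudo_division f.
have r0 : r = 0.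
  apply: (phi_small_eq0 sr); have -> : r = a ^+ N *: f - q * relation by rewrite e addrC addKr.
  by rewrite rmorphB rmorphM phi_relation mulr0 -mul_polyC rmorphM pf mulr0 subrr.
have : divides relation (a ^+ N *: f) by exists q; rewrite e r0 addr0 mulrC.
elim: N {e} => [|N IH]; first by rewrite expr0 scale1r.
by rewrite exprS -scalerA => /relation_cancel_a.
Qed.

Lemma relation_prime : prime_ideal (pideal relation).
Proof.
split.
- split; first by exists 0; rewrite mulr0.
    by move=> x y [u ->] [v ->]; exists (u + v); rewrite mulrDr.
  by move=> r x [u ->]; exists (r * u); rewrite mulrCA.
- by move=> /phi_kernel; rewrite rmorph1 => /eqP; rewrite oner_eq0.
- move=> x y /phi_kernel; rewrite rmorphM => /eqP; rewrite mulf_eq0.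
  by case/orP=> /eqP /phi_kernel; [left|right].
Qed.

End Kummer.

Lemma factor_surjection (P B K : nzRingType) (pi : {rmorphism P -> B})
  (phi : {rmorphism P -> K}) : (forall y, exists f, pi f = y) ->
  (forall f, pi f = 0 -> phi f = 0) ->
  exists psi : {rmorphism B -> K}, forall f, psi (pi f) = phi f.
Proof.
move=> surj ker.
pose s y := projT1 (constructive_indefinite_description _ (surj y)).
have sK y : pi (s y) = y by rewrite /s; case: constructive_indefinite_description.
have phiE f g : pi f = pi g -> phi f = phi g.
  by move=> e; apply/subr0_eq; rewrite -rmorphB ker // rmorphB e subrr.
pose psi y := phi (s y).
have psiB : {morph psi : x y / x - y}.
  by move=> x y; rewrite /psi -rmorphB; apply: phiE; rewrite rmorphB !sK.
have psiM : monoid_morphism psi.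
  split; first by rewrite /psi -(rmorph1 phi); apply: phiE; rewrite sK rmorph1.
  by move=> x y; rewrite /psi -rmorphM; apply: phiE; rewrite rmorphM !sK.
pose h : {rmorphism B -> K} :=
  HB.pack psi (GRing.isZmodMorphism.Build _ _ psi psiB) (GRing.isMonoidMorphism.Build _ _ psi psiM).
by exists h => f; apply: phiE; rewrite sK.
Qed.

(** * Extraction of primes and Krull's intersection theorem *)

Section PrimeRemoval.
Context (R : idomainType).
Implicit Types x y w p : R.

Lemma extract_prime p x k : ~ divides (p ^+ k) x ->
  exists m y, x = p ^+ m * y /\ ~ divides p y.
Proof.
elim: k x => [|k IH] x nd; first by case: nd; rewrite expr0; apply/divides_unit/unitr1.
have [[y ey]|npx] := classic (divides p x); last by exists 0%N, x; rewrite expr0 mul1r.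
have [|m [w [ew nw]]] := IH y; last by exists m.+1, w; rewrite ey ew exprS mulrA.
by move=> [w ew]; apply: nd; exists w; rewrite ey ew exprS mulrA.
Qed.

(** The primes are split off in turn. That [w] divides a power of their product makes it a divisor
    of a power of [a] in the application. *)
Lemma extract_primes (s : seq R) x :
  (forall p, p \in s -> prime_elt p /\ exists k, ~ divides (p ^+ k) x) ->
  exists w y M, [/\ x = w * y, factorable w, divides w ((\prod_(p <- s) p) ^+ M)
    & forall p, p \in s -> ~ divides p y].
Proof.
elim: s => [|p s IH] hs.
  exists 1, x, 0%N; rewrite mul1r; split=> //; first exact/factorable_unit/unitr1.
  exact/divides_unit/unitr1.
have [q qs|w [y [M [ex fw dw ny]]]] := IH; first by apply: hs; rewrite in_cons qs orbT.
have [pp [k nk]] := hs p (mem_head _ _).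
have [|m [t [ey nt]]] := @extract_prime p y k.
  by move=> dk; apply: nk; rewrite ex; apply: divides_mull.
exists (w * p ^+ m), t, (M + m)%N; split.
- by rewrite ex ey mulrA.
- by apply: factorableM => //; apply/factorableX/factorable_prime.
- rewrite big_cons; set S := \prod_(_ <- s) _ in dw *.
  have [c ec] := dw; exists (c * p ^+ M * S ^+ m).
  by rewrite exprMn !exprD ec; ring.
- move=> q; rewrite inE => /orP[/eqP -> //|qs dq]; apply: (ny q qs).
  by rewrite ey; apply: divides_mull.
Qed.

Lemma factorable_prod (s : seq R) : (forall y, y \in s -> factorable y) ->
  factorable (\prod_(y <- s) y).
Proof.
elim: s => [|y s IH] fs; first by rewrite big_nil; apply/factorable_unit/unitr1.
rewrite big_cons; apply: factorableM; first by apply/fs/mem_head.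
by apply: IH => z zs; apply: fs; rewrite in_cons zs orbT.
Qed.

(* Krull's intersection theorem for the principal ideal [p] of the domain [R / b]. *)
Lemma krull_mod_prime p b x : noetherian R -> prime_elt b -> ~ divides b p ->
  ~ sum2ideal p b 1 -> ~ divides b x ->
  exists k, forall g h, x <> p ^+ k * g + b * h.
Proof.
move=> noeth pb nbp nJ nbx; apply: NNPP => none.
have ex k : exists g, exists h, x = p ^+ k * g + b * h.
  apply: NNPP => nk; apply: none; exists k => g h e; apply: nk; by exists g, h.
pose g k := projT1 (constructive_indefinite_description _ (ex k)).
have gP k : exists h, x = p ^+ k * g k + b * h.
  by rewrite /g; case: constructive_indefinite_description.
have [b0 nb prb] := pb.
(* Modulo [b], the cofactors satisfy [g k = p * g k.+1], as [p] is nonzero in the domain R / b. *)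
have step k : divides b (g k - p * g k.+1).
  have [h eh] := gP k; have [h' eh'] := gP k.+1.
  have : divides b (p ^+ k * (g k - p * g k.+1)).
    exists (h' - h); rewrite exprS in eh'.
    have -> : p ^+ k * (g k - p * g k.+1) = (p ^+ k * g k + b * h)
      - (p * p ^+ k * g k.+1 + b * h') + b * (h' - h) by ring.
    by rewrite -eh -eh' subrr add0r.
  by case/prb => // /(prime_divides_exp pb).
(* Hence the ideals generated by [g k] and [b] increase, and they become stationary. *)
have [k|k y [u [v ->]]|N stab] := noeth (fun k => sum2ideal (g k) b).
- split; first by exists 0, 0; rewrite !mulr0 addr0.
    by move=> _ _ [u [v ->]] [u' [v' ->]]; exists (u + u'), (v + v'); ring.
  by move=> r _ [u [v ->]]; exists (r * u), (r * v); ring.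
- have [c ec] := step k; exists (p * u), (c * u + v).
  have -> : g k = p * g k.+1 + b * c by rewrite -ec; ring.
  ring.
have [|u [v e]] := stab N.+1 (g N.+1) (leqnSn N).
  by exists 1, 0; rewrite mulr1 mulr0 addr0.
have [c ec] := step N.
(* Stationarity gives [g N.+1 = p * u * g N.+1] modulo [b]: either [g N.+1] vanishes there, and so
   does [x], or [p] is invertible modulo [b]. *)
have : divides b (g N.+1 * (1 - p * u)).
  exists (c * u + v).
  have -> : g N.+1 * (1 - p * u) = (g N.+1 - g N * u) + (g N - p * g N.+1) * u by ring.
  by rewrite {1}e ec; ring.
case/prb=> [dg|[w ew]].
  apply: nbx; have [h ->] := gP N.+1; apply: dividesD; first exact: divides_mull.
  exact/divides_mulr/divides_refl.
by apply: nJ; exists u, w; rewrite -ew; ring.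
Qed.

End PrimeRemoval.

(** * The quotient ring *)

Section Quotient.
Context (A : idomainType) (G : int -> A -> Prop) (a b : A) (n : nat) (da db : int).
Hypothesis hG : is_Zgrading G.
Hypotheses (a0 : a != 0) (b0 : b != 0) (ga : G da a) (gb : G db b).
Hypothesis cop : forall x, divides a x /\ divides b x <-> divides (a * b) x.
Hypotheses (n_gt0 : (0 < n)%N) (co : gcdz n%:Z (db - da) = 1).
Local Notation K := {fraction A}.
Local Notation d := (db - da).
Local Notation relation := (a%:P * 'X^n - b%:P : {poly A}).
Context (rho zeta : K) (phi : {rmorphism {poly A} -> K}).
Hypothesis tw : twisting_pair G a b n da db rho zeta.
Hypothesis phiC : forall i x, G i x -> phi x%:P = x%:F * rho ^ i.
Hypothesis phiX : phi 'X = zeta.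
Context (B : idomainType) (pi : {rmorphism {poly A} -> B}) (psi : {rmorphism B -> K}).
Hypothesis pi_surj : forall y, exists f, pi f = y.
Hypothesis pi_kernel : forall f, pi f = 0 <-> pideal relation f.
Hypothesis psi_pi : forall f, psi (pi f) = phi f.
Local Notation z := (pi 'X).
Local Notation iota x := (pi x%:P).

Lemma psi_inj y : psi y = 0 -> y = 0.
Proof.
have [f <-] := pi_surj y; rewrite psi_pi => pf; apply/pi_kernel.
exact/(phi_kernel hG a0 b0 ga gb cop n_gt0 co tw phiC phiX).
Qed.

(** The quotients of values of [psi] contain [rho], hence each homogeneous [x] as [x * rho ^ i]
    divided by [rho ^ i], hence all of [A]. *)
Lemma fraction_isomorphism : twisting_generates G rho zeta ->
  exists h : {rmorphism {fraction B} -> K}, bijective h.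
Proof.
move=> gen; apply: (fraction_bijection psi_inj) => k.
have hF := subfield_quotients psi_inj; have [F1 FB FM FV] := hF.
have FG i x : G i x -> quotients psi (x%:F * rho ^ i).
  by move=> gx; rewrite -(phiC gx) -psi_pi; apply: quotients_psi.
have Fz : quotients psi zeta by rewrite -phiX -psi_pi; apply: quotients_psi.
have Fr := gen _ hF FG Fz; have [r0 _ _ _ _] := tw.
have FA x : quotients psi x%:F.
  have [_ _ _ dec _] := hG; have [s [f [_ hf ->]]] := dec x.
  have F0 : quotients psi 0 by rewrite -(subrr 1); apply: FB.
  have FD u v : quotients psi u -> quotients psi v -> quotients psi (u + v).
    by move=> hu hv; rewrite -[v]opprK -[- v]sub0r; apply: (FB) => //; apply: (FB).
  have Ff i : quotients psi (f i)%:F.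
    have -> : (f i)%:F = (f i)%:F * rho ^ i * rho ^ (- i) :> K.
      by rewrite -mulrA -expfzDr // subrr expr0z mulr1.
    by apply: (FM); [apply: FG|apply: subfieldXz].
  by rewrite rmorph_sum; apply: (big_ind (quotients psi) F0 FD) => i _; apply: Ff.
have [x [y [_ ->]]] := fraction_div k.
by apply: (FM); [|apply: (FV)]; apply: FA.
Qed.

(** The degree of [K] pulled back along the embedding [psi]; for [x] of degree [i], the class of
    [x Z^j] has degree [n i + d j]. *)
Definition quotient_grade m (h : B) := hfrac G m (psi h).

Lemma quotient_grading : is_Zgrading quotient_grade.
Proof.
split.
- by move=> m; rewrite /quotient_grade rmorph0; apply: hfrac0.
- by move=> m x y hx hy; rewrite /quotient_grade rmorphB; apply: hfracB.
- by move=> i j x y hx hy; rewrite /quotient_grade rmorphM; apply: hfracM.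
- move=> y; have [f <-] := pi_surj y.
  have [I [i [x [j [_ _ gx ->]]]]] := monomial_decomposition hG (leqnn (size f)).
  pose deg p := n%:Z * i p + d * (j p)%:Z; pose k p := pi ((x p)%:P * 'X^(j p)).
  (* Exponents may exceed [n] here, so several monomials can share a degree and are added up. *)
  exists (undup (map deg (index_enum I))), (fun m => \sum_(p <- index_enum I | deg p == m) k p).
  rewrite undup_uniq rmorph_sum sum_by_degree; split=> // m.
  rewrite /quotient_grade rmorph_sum; apply: (big_ind (hfrac G m)) => [|u v hu hv|p /eqP <-].
  + exact: hfrac0.
  + by rewrite -[v]opprK; apply: hfracB => //; apply: hfracN.
  + by rewrite psi_pi; apply: (hfrac_monomial hG tw phiC phiX).
- move=> s f us hf sf m ms; apply: psi_inj.
  have sum0 : \sum_(m <- s) psi (f m) = 0 by rewrite -rmorph_sum sf rmorph0.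
  have := hfrac_components (deg := id) hG hf sum0 m.
  rewrite (big_rem m) //= eqxx big1_seq ?addr0 // => e.
  by rewrite mem_rem_uniq // inE /= => /andP[/eqP -> /andP[/eqP]].
Qed.

Lemma homogeneous_iota x : homogeneous G x -> homogeneous quotient_grade (iota x).
Proof.
move=> [i gx]; exists (n%:Z * i + d * 0); rewrite /quotient_grade psi_pi.
rewrite -[x%:P]mulr1 -(expr0 'X); exact: (hfrac_monomial hG tw phiC phiX).
Qed.

Lemma iota_b : iota b = iota a * z ^+ n.
Proof.
apply/esym/subr0_eq; rewrite -rmorphXn -rmorphM -rmorphB.
by apply/pi_kernel; apply: divides_refl.
Qed.

Lemma iotaM x y : iota (x * y) = iota x * iota y.
Proof. by rewrite polyCM rmorphM. Qed.

Lemma iotaX x k : iota (x ^+ k) = iota x ^+ k.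
Proof. by rewrite polyC_exp rmorphXn. Qed.

Lemma iota_prod (s : seq A) : iota (\prod_(y <- s) y) = \prod_(y <- s) iota y.
Proof. by elim: s => [|y s IH]; rewrite ?big_nil ?rmorph1 // !big_cons iotaM IH. Qed.

Lemma divides_iota x y : divides x y -> divides (iota x) (iota y).
Proof. by move=> [w ->]; exists (iota w); apply: iotaM. Qed.

Lemma pi_small_eq0 (r : {poly A}) : (size r <= n)%N -> pi r = 0 -> r = 0.
Proof.
move=> sr pr; apply: (phi_small_eq0 hG a0 b0 n_gt0 co tw phiC phiX sr).
by rewrite -psi_pi pr rmorph0.
Qed.

Lemma iota_neq0 x : x != 0 -> iota x != 0.
Proof.
apply: contra_neq => px; apply/eqP; rewrite -polyC_eq0; apply/eqP/pi_small_eq0 => //.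
by rewrite (leq_trans (size_polyC_leq1 x)).
Qed.

Lemma iota_unit x : x \is a GRing.unit -> iota x \is a GRing.unit.
Proof.
move=> ux; apply/unitrP; exists (iota x^-1).
by rewrite -!iotaM mulVr // mulrV // rmorph1.
Qed.

Lemma pi_pseudo_division (f : {poly A}) : exists N (r : {poly A}),
  (size r <= n)%N /\ iota a ^+ N * pi f = pi r.
Proof.
have [N [q [r [sr e]]]] := pseudo_division b a0 n_gt0 f; exists N, r; split=> //.
rewrite -iotaX -rmorphM mul_polyC e rmorphD rmorphM.
have -> : pi relation = 0 by apply/pi_kernel/divides_refl.
by rewrite mulr0 add0r.
Qed.

(** A power of [a] brings [h] to a representative of size at most [n], where a homogeneous element
    can only be a single monomial. *)
Lemma homogeneous_reduce h : homogeneous quotient_grade h ->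
  exists N x (j : nat), homogeneous G x /\ iota a ^+ N * h = iota x * z ^+ j.
Proof.
move=> hh; have [f ef] := pi_surj h; have [N [r [sr er]]] := pi_pseudo_division f.
rewrite ef in er.
have [m hm] : homogeneous quotient_grade (pi r).
  rewrite -er -iotaX; apply: (homogeneousM quotient_grading) => //.
  apply: homogeneous_iota; elim: N {er} => [|N [e IH]]; first by exists 0; apply: gr1.
  by rewrite exprS; exists (da + e); apply: grM.
rewrite /quotient_grade psi_pi in hm.
have [i [x [j [gx e]]]] := small_homogeneous hG a0 b0 n_gt0 co tw phiC phiX sr hm.
exists N, x, j; split; first by exists i.
by rewrite er e rmorphM rmorphXn.
Qed.

Lemma coef0_relationM (f : {poly A}) : (relation * f)`_0 = - (b * f`_0).
Proof.
by rewrite coef0M coefB coefCM coefXn coefC /= -[0%N == n]negbK eq_sym -lt0n n_gt0 mulr0 sub0r mulNr.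
Qed.

Lemma pi_eq (f g : {poly A}) : pi f = pi g -> exists h, f = g + relation * h.
Proof.
move=> e; have [h eh] : pideal relation (f - g) by apply/pi_kernel; rewrite rmorphB e subrr.
by exists h; rewrite -eh addrC subrK.
Qed.

(** * Factoriality of the quotient ring *)

Section Factorial.
Hypotheses (uA : UFD A) (pb : prime_elt b) (nA : noetherian A).
Hypothesis sum_prime : forall p, prime_elt p -> divides p a ->
  ~ sum2ideal p b 1 -> prime_ideal (sum2ideal p b).

Lemma b_ndivides_a : ~ divides b a.
Proof.
move=> dba; have [_ /negP nb _] := pb.
have [w e] : divides (a * b) a by apply/cop; split=> //; apply: divides_refl.
apply: nb; apply: (divides_unitr (unitr1 A)); exists w.
by apply: (mulfI a0); rewrite mulr1 mulrA.
Qed.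

(** This is B / z = A / b: setting Z = 0 turns the relation into [- b], and conversely
    [iota b = iota a * z ^ n] is a multiple of [z] as [n > 0]. *)
Lemma divides_z (f : {poly A}) : divides z (pi f) <-> divides b f`_0.
Proof.
split=> [[y]|[c ec]].
  have [g <-] := pi_surj y; rewrite -rmorphM => /pi_eq[h ->].
  rewrite coefD coefXM coef0_relationM add0r.
  by apply/dividesN/divides_mulr/divides_refl.
elim/poly_ind: f ec => [|f e _]; first by rewrite rmorph0 => _; apply: divides0.
rewrite coefD coefMX coefC /= add0r => ->.
rewrite rmorphD rmorphM; apply: dividesD; first exact/divides_mull/divides_refl.
rewrite iotaM iota_b -(prednK n_gt0) exprS.
exact/divides_mulr/divides_mull/divides_mulr/divides_refl.
Qed.

Lemma prime_z : prime_elt z.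
Proof.
have [b1 /negP nb prb] := pb; split.
- apply: contraNneq (iota_neq0 b1) => z0.
  by rewrite iota_b z0 expr0n (gtn_eqF n_gt0) mulr0.
- apply/negP => uz; apply: nb; apply: (divides_unitr (unitr1 A)).
  by have /divides_z := divides_unit (pi 1) uz; rewrite coef1.
- move=> x y; have [f <-] := pi_surj x; have [g <-] := pi_surj y.
  by rewrite -rmorphM => /divides_z; rewrite coef0M => /prb[]; [left|right]; apply/divides_z.
Qed.

(** This is B / p = (A / (p, b))[Z]: since [p] divides [a], the relation reduces to [- b] modulo
    [p], and [iota b] is a multiple of [iota p]. *)
Lemma divides_iota_prime p (f : {poly A}) : divides p a ->
  divides (iota p) (pi f) <-> forall i, sum2ideal p b f`_i.
Proof.
move=> [a' ea]; split=> [[y]|h].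
  have [g <-] := pi_surj y; rewrite -rmorphM => /pi_eq[h ->] i.
  have -> : p%:P * g + relation * h = p *: (g + a'%:P * 'X^n * h) - b *: h.
    by rewrite -!mul_polyC ea polyCM; ring.
  rewrite coefB !coefZ -mulrN.
  by exists (g + a'%:P * 'X^n * h)`_i, (- h`_i).
rewrite -[f]coefK poly_def rmorph_sum; apply: divides_sum => i _.
rewrite -mul_polyC rmorphM; apply: divides_mulr; have [u [v ->]] := h i.
rewrite polyCD rmorphD; apply: dividesD.
  by apply: divides_iota; apply/divides_mulr/divides_refl.
rewrite iotaM iota_b; do 2!apply: divides_mulr.
by apply: divides_iota; exists a'.
Qed.

Lemma is_ideal_sum2ideal p : is_ideal (sum2ideal p b).
Proof.
split; first by exists 0, 0; rewrite !mulr0 addr0.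
  by move=> _ _ [u [v ->]] [u' [v' ->]]; exists (u + u'), (v + v'); ring.
by move=> r _ [u [v ->]]; exists (r * u), (r * v); ring.
Qed.

(** The quotient B / p is zero if 1 lies in the ideal of [p] and [b], and otherwise a polynomial
    ring over the domain given by [sum_prime]. *)
Lemma prime_or_unit_iota p : prime_elt p -> divides p a ->
  (sum2ideal p b 1 /\ iota p \is a GRing.unit) \/
  (~ sum2ideal p b 1 /\ prime_elt (iota p)).
Proof.
move=> pp dpa; have [J1|nJ1] := classic (sum2ideal p b 1); [left|right]; split=> //.
  apply: (divides_unitr (unitr1 B)); rewrite -(rmorph1 pi).
  apply/(divides_iota_prime _ dpa) => i; rewrite coef1.
  by case: eqP => _ //; case: (is_ideal_sum2ideal p).
have [p0 np pr] := pp; have [hJ _ prJ] := sum_prime pp dpa nJ1; split.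
- exact: iota_neq0.
- apply/negP => /(divides_unit (pi 1)) /(divides_iota_prime _ dpa) /(_ 0%N).
  by rewrite coef1.
- move=> x y; have [f <-] := pi_surj x; have [g <-] := pi_surj y.
  rewrite -rmorphM => /(divides_iota_prime _ dpa) dfg.
  case: (classic (divides (iota p) (pi f))) => [|nf]; [by left|right].
  apply: NNPP => ng.
  have some (h : {poly A}) : ~ divides (iota p) (pi h) -> exists i, ~ sum2ideal p b h`_i.
    move=> nh; apply: NNPP => none; apply: nh; apply/(divides_iota_prime _ dpa) => i.
    by apply: NNPP => ni; apply: none; exists i.
  have [i [j [ni nj]]] := least_coef_product hJ dfg (some _ nf) (some _ ng).
  by case/prJ.
Qed.

Lemma factorable_iota_a : factorable (iota a).
Proof.
have [k [u [s [uu ps _ ea]]]] := UFD_factorable uA a0.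
rewrite ea iotaM iota_prod; apply: factorableM; first exact/factorable_unit/iota_unit.
rewrite -(big_map (fun p => iota p) xpredT id); apply: factorable_prod => _ /mapP[p sp ->].
have dp : divides p a.
  by rewrite ea (big_rem p) //= mulrCA; apply/divides_mulr/divides_refl.
by case: (prime_or_unit_iota (ps p sp) dp) => -[_]; [exact: factorable_unit|exact: factorable_prime].
Qed.

Lemma factorable_iota_b : factorable (iota b).
Proof.
rewrite iota_b; apply: factorableM; first exact: factorable_iota_a.
exact/factorableX/factorable_prime/prime_z.
Qed.

(** Constant coefficients modulo [b] carry the divisibility back to [A], where [krull_mod_prime]
    bounds the exponent. *)
Lemma iota_divides_exp p c k : divides (iota p ^+ k) (iota c) ->
  exists g h, c = p ^+ k * g + b * h.
Proof.
move=> [y]; have [g <-] := pi_surj y; rewrite -iotaX -rmorphM => /pi_eq[h].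
move/(congr1 (fun f : {poly A} => f`_0)).
rewrite coefD coef0_relationM coefC coefCM /= -mulrN => ->.
by exists g`_0, (- h`_0).
Qed.

(** Pseudo-division replaces the cofactor by [r] of size at most [n]; then [a ^ N * x = q * r]
    already holds in [A[Z]], and constant coefficients are compared. *)
Lemma iota_divides_up_to_a q x : ~ divides q a -> prime_elt q ->
  divides (iota q) (iota x) -> divides q x.
Proof.
move=> nqa pq [y]; have [g <-] := pi_surj y; have [N [r [sr er]]] := pi_pseudo_division g.
move=> e; have e0 : a ^+ N *: x%:P - q *: r = 0.
  apply: pi_small_eq0.
    apply: (leq_trans (size_polyD _ _)); rewrite size_polyN geq_max.
    rewrite !(leq_trans (size_scale_leq _ _)) //.
    by rewrite (leq_trans (size_polyC_leq1 x)).
  rewrite -!mul_polyC rmorphB !rmorphM [pi x%:P]e -er iotaX; ring.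
have : divides q (a ^+ N * x).
  exists r`_0; have := congr1 (fun f : {poly A} => f`_0) (subr0_eq e0).
  by rewrite !coefZ coefC.
by case: pq => q0 nq pr /pr[/(prime_divides_exp (And3 q0 nq pr))|].
Qed.

(** Up to powers of [a] both factors are monomials in [z]; trading the powers of [z] for powers of
    [b] gives a divisibility in [A], where [q] is prime. *)
Lemma iota_prime_up_to_a q h1 h2 : ~ divides q a -> ~ divides q b -> prime_elt q ->
  homogeneous quotient_grade h1 -> homogeneous quotient_grade h2 ->
  divides (iota q) (h1 * h2) ->
  exists N, divides (iota q) (iota a ^+ N * h1) \/ divides (iota q) (iota a ^+ N * h2).
Proof.
move=> nqa nqb pq /homogeneous_reduce[N [x [i [_ ex]]]] /homogeneous_reduce[M [y [j [_ ey]]]] dq.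
have [q0 nq pr] := pq.
have : divides q (x * y * b ^+ (i + j)).
  apply: iota_divides_up_to_a => //; rewrite !iotaM iotaX iota_b exprMn -exprM.
  (* The factor [b ^ (i + j)] contributes [z ^ (n * (i + j))], which by [n > 0] has enough factors
     [z] to complete both monomials. *)
  have -> : (n * (i + j) = (i + j) + n.-1 * (i + j))%N by rewrite -[in LHS](prednK n_gt0).
  have -> : iota x * iota y * (iota a ^+ (i + j) * z ^+ (i + j + n.-1 * (i + j))) =
      (iota x * z ^+ i) * (iota y * z ^+ j) * (iota a ^+ (i + j) * z ^+ (n.-1 * (i + j))).
    by rewrite !exprD; ring.
  rewrite -ex -ey; apply: divides_mulr.
  have -> : iota a ^+ N * h1 * (iota a ^+ M * h2) = h1 * h2 * (iota a ^+ N * iota a ^+ M) by ring.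
  exact: divides_mulr.
case/pr => [/pr[dx|dy]|/(prime_divides_exp pq)//].
  by exists N; left; rewrite ex; apply/divides_mulr/divides_iota.
by exists M; right; rewrite ey; apply/divides_mulr/divides_iota.
Qed.

(** If [q] divides [a] or is associated to [b], the factorization is known. Otherwise the primes
    coming from [a] are divided out of [iota q], finitely often by Krull, and the remaining factor
    [y] is prime or a unit. *)
Lemma factorable_iota_prime q : prime_elt q -> homogeneous G q -> factorable (iota q).
Proof.
move=> pq hq; have [q0 /negP nq pr] := pq.
have [[c ec]|nqa] := classic (divides q a).
  by have dq : divides q a by [exists c]; case: (prime_or_unit_iota pq dq) => -[_];
    [exact: factorable_unit|exact: factorable_prime].
have assoc : divides q b -> divides b q.
  move=> /(irreducible_divides (prime_irreducible pq) (prime_irreducible pb))[u uu ->].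
  by exists u^-1; rewrite mulrK.
have [/(irreducible_divides (prime_irreducible pb) (prime_irreducible pq))[u uu ->]|nbq] :=
  classic (divides b q).
  by rewrite iotaM; apply: factorableM; [exact: factorable_iota_b|exact/factorable_unit/iota_unit].
have nqb : ~ divides q b by move/assoc.
have [k [u [s [uu ps _ ea]]]] := UFD_factorable uA a0.
have sa p : p \in s -> divides p a.
  by move=> sp; rewrite ea (big_rem p) //= mulrCA; apply/divides_mulr/divides_refl.
pose s' := [seq iota p | p <- s & iota p \isn't a GRing.unit].
have s'P P : P \in s' -> prime_elt P /\ exists k, ~ divides (P ^+ k) (iota q).
  move=> /mapP[p]; rewrite mem_filter => /andP[/negP nu sp] ->.
  have [[_ //]|[nJ pp]] := prime_or_unit_iota (ps p sp) (sa p sp); split=> //.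
  have nbp : ~ divides b p by move=> h; apply/b_ndivides_a/(divides_trans h)/sa.
  have [k' hk] := krull_mod_prime nA pb nbp nJ nbq; exists k'.
  by move=> /iota_divides_exp[g [h e]]; apply: (hk g h).
have [w [y [M [eq fw [c ec] ny]]]] := extract_primes s'P.
have dsa : divides (\prod_(P <- s') P) (iota a).
  rewrite ea iotaM iota_prod /s' big_map big_filter.
  rewrite [X in divides _ (_ * X)](bigID (fun p => iota p \isn't a GRing.unit)) /=.
  exact/divides_mull/divides_mulr/divides_refl.
have dwa : divides w (iota a ^+ M).
  by have [v ->] := dsa; exists (c * v ^+ M); rewrite exprMn ec mulrA.
have y0 : y != 0 by apply: contraNneq (iota_neq0 q0) => y0; rewrite eq y0 mulr0.
have hy : homogeneous quotient_grade y.
  apply: (homogeneous_divides quotient_grading (iota_neq0 q0)); first exact: homogeneous_iota.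
  by exists w; rewrite eq mulrC.
(* No prime factor of [iota a] divides [y], so powers of [iota a] cancel modulo [y]. *)
have cancel N h : divides y (iota a ^+ N * h) -> divides y h.
  move=> [t et]; have /gauss : divides (iota a ^+ N) (y * t) by exists h.
  case=> [||v ev].
  - exact/factorableX/factorable_iota_a.
  - move=> P pP /(prime_divides_exp pP); rewrite ea iotaM iota_prod.
    have [P0 /negP nP prP] := pP.
    case/prP => [/(divides_unitr (iota_unit uu))//|].
    rewrite -(big_map (fun p => iota p) xpredT id) => /(prime_divides_prod pP)[_ /mapP[p sp ->] dP] dPy.
    have [[_ /divides_unitr/(_ dP)]//|[_ pp]] := prime_or_unit_iota (ps p sp) (sa p sp).
    have [v vu ev] := irreducible_divides (prime_irreducible pP) (prime_irreducible pp) dP.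
    apply: (ny (iota p)).
      by apply/mapP; exists p => //; rewrite mem_filter sp andbT; case: pp.
    by have [t' ->] := dPy; exists (v^-1 * t'); rewrite ev -mulrA mulVKr.
  exists v; have aN : iota a ^+ N != 0 by rewrite expf_neq0 // iota_neq0.
  by apply: (mulfI aN); rewrite et ev mulrCA.
rewrite eq; apply: factorableM => //.
have [/factorable_unit//|uy] := boolP (y \is a GRing.unit).
apply/factorable_prime/(homogeneous_prime_test quotient_grading) => // h1 h2 hh1 hh2 [t et].
have dyq : divides y (iota q) by exists w; rewrite eq mulrC.
have ha : homogeneous quotient_grade (iota a ^+ M).
  rewrite -iotaX; apply: homogeneous_iota.
  elim: (M) => [|N [e IH]]; first by exists 0; apply: gr1.
  by rewrite exprS; exists (da + e); apply: grM.
(* As [iota q = w * y] and [w] divides [iota a ^ M], divisibility of [h1 * h2] by [y] makes [iota q]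
   divide [iota a ^ M * h1 * h2]. *)
have [|N [/(divides_trans dyq)|/(divides_trans dyq)/cancel]] :=
  iota_prime_up_to_a nqa nqb pq (homogeneousM quotient_grading ha hh1) hh2.
- rewrite -mulrA et eq; have [v ->] := dwa; exists (v * t); ring.
- by move/cancel/cancel; left.
- by right.
Qed.

(** By Nagata's descent it is enough to factor a homogeneous [h]. It divides some [iota x * z ^ j]
    with [x] homogeneous, and the primes of [x] in [A] are homogeneous as divisors of [x]. *)
Lemma quotient_UFD : UFD B.
Proof.
apply: factorable_UFD; apply: (graded_factorable quotient_grading) => h hh h0.
have [N [x [j [hx e]]]] := homogeneous_reduce hh.
have x0 : x != 0.
  apply: contraNneq h0 => x0; move/eqP: e; rewrite x0 polyC0 rmorph0 mul0r mulf_eq0.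
  by rewrite expf_eq0 (negbTE (iota_neq0 a0)) andbF.
apply: (@factorable_divides _ h (iota x * z ^+ j)); last first.
  by exists (iota a ^+ N); rewrite -e mulrC.
apply: factorableM; last exact/factorableX/factorable_prime/prime_z.
have [k [u [s [uu ps _ ex]]]] := UFD_factorable uA x0.
rewrite ex iotaM iota_prod; apply: factorableM; first exact/factorable_unit/iota_unit.
rewrite -(big_map (fun p => iota p) xpredT id); apply: factorable_prod => _ /mapP[p sp ->].
apply: factorable_iota_prime; first exact: ps.
apply: (homogeneous_divides hG x0 hx); rewrite ex (big_rem p) //= mulrCA.
exact/divides_mulr/divides_refl.
Qed.

End Factorial.
End Quotient.

Theorem theorem3p16 (A : idomainType) (G : int -> A -> Prop) (a b : A) (n : nat)
  (da db : int) :
  is_Zgrading G -> a != 0 -> b != 0 -> G da a -> G db b ->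
  (forall x : A, (divides a x /\ divides b x) <-> divides (a * b) x) ->
  (0 < n)%N -> gcdz n%:Z (db - da) = 1%N ->
  (* (a) *)
  prime_ideal (pideal (a%:P * 'X^n - b%:P : {poly A}))
  /\
  (* (b) *)
  (noetherian A -> UFD A -> prime_elt b ->
   (forall p : A, prime_elt p -> divides p a -> ~ sum2ideal p b 1 ->
      prime_ideal (sum2ideal p b)) ->
   forall (B : idomainType) (pi : {rmorphism {poly A} -> B}),
     (forall y : B, exists f, pi f = y) ->
     (forall f, pi f = 0 <-> pideal (a%:P * 'X^n - b%:P) f) ->
     UFD B /\
     exists phi : {rmorphism {fraction B} -> {fraction A}}, bijective phi).
Proof.
move=> hG a0 b0 ga gb cop n_gt0 co.
(* The grading is replaced by one that is concentrated in degree 0 or has a nonzero homogeneous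
   fraction of degree 1. *)
have {G da db hG ga gb co} [G [da [db [hG ga gb co norm]]]] :
    exists (G' : int -> A -> Prop) da' db', [/\ is_Zgrading G', G' da' a, G' db' b,
      gcdz n%:Z (db' - da') = 1 & (forall m x, G' m x -> x != 0 -> m = 0) \/
      exists y, y != 0 /\ hfrac G' 1 y].
  have [triv|[e [e0 he div unit_degree]]] := normalized_grading hG.
    by exists G, da, db; split=> //; left.
  have /dvdzP[da' eda] := div _ _ ga a0; have /dvdzP[db' edb] := div _ _ gb b0.
  exists (fun m => G (e * m)), da', db'; rewrite ![e * _]mulrC -eda -edb.
  split=> //; last by right.
  (* The new degree difference divides the old one, so it stays coprime to [n]. *)
  have : (gcdz n%:Z (db' - da') %| gcdz n%:Z (db - da))%Z.
    by rewrite dvdz_gcd dvdz_gcdl eda edb -mulrBl dvdz_mulr // dvdz_gcdr.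
  by rewrite co dvdz1 /gcdz => /eqP /= ->.
have [rho [zeta [tw gen]]] := twisting_pair_exists hG a0 b0 ga gb n_gt0 co norm.
have [phi [phiC phiX]] : exists phi : {rmorphism {poly A} -> {fraction A}},
    (forall i x, G i x -> phi x%:P = x%:F * rho ^ i) /\ phi 'X = zeta.
  by apply: twisted_evaluation_exists => //; case: tw.
split=> [|nA uA pb sum_prime B pi surj ker].
  exact: (relation_prime hG a0 b0 ga gb cop n_gt0 co tw phiC phiX).
have phi_ker f := phi_kernel hG a0 b0 ga gb cop n_gt0 co tw phiC phiX f.
have [psi psi_pi] : exists psi : {rmorphism B -> {fraction A}}, forall f, psi (pi f) = phi f.
  by apply: factor_surjection => // f /ker /phi_ker.
split.
  exact: (quotient_UFD hG a0 b0 ga gb cop n_gt0 co tw phiC phiX surj ker psi_pi uA pb nA sum_prime).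
exact: (fraction_isomorphism hG a0 b0 ga gb cop n_gt0 co tw phiC phiX surj ker psi_pi gen).
Qed.
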